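(* (1) If there is a measurable cardinal, then the lightface inner-model reflection principle holds. (2) Indeed, if $\kappa$ is a measurable cardinal, then the inner-model reflection principle holds for assertions with parameters in $V_\kappa$. (3) Consequently, if there is a proper class of measurable cardinals, then the full inner-model reflection principle holds for arbitrary parameters.
   Context: An \emph{inner model} is a transitive class containing all ordinals and satisfying $\mathrm{ZFC}$. The \emph{inner-model reflection principle} is the schema asserting, for each formula $\varphi$ in the first-order language of set theory and each set $a$, that if $\varphi(a)$ is true in $V$, then there is an inner model $W\subsetneq V$ with $a\in W$ and $W\models\varphi(a)$. It is expressed in the second-order language of set theory (e.g. in $\mathrm{GBC}$), with the quantifier over $W$ ranging over classes. (One may equivalently require only $W\models\mathrm{ZF}$.) The principle \emph{for assertions with parameters in $X$} is the restriction to $a\in X$; the \emph{lightface} form is the restriction to sentences (no parameters). *)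

(* Defs.v *)
(** * Structures for the language of set theory *)

Record estruct : Type := EStruct {
  dom :> Type;
  mem : dom -> dom -> Prop
}.
Arguments EStruct {dom} _.
Arguments mem {e} _ _.

Notation "x ∈ y" := (mem x y) (at level 70, no associativity).

Definition substruct (M : estruct) (W : M -> Prop) : estruct :=
  EStruct (fun x y : {x : M | W x} => proj1_sig x ∈ proj1_sig y).

(** * First-order formulas *)

(** [X] is the type of free set variables and [C] the type of class variables,
    which are never quantified.  A quantifier binds the new variable [None].
    The language of set theory proper is [C := Empty_set]; a sentence has
    [X := Empty_set], a formula in one free variable has [X := unit].  The other
    connectives and the existential quantifier are the usual classical
    abbreviations. *)
Inductive formula (C : Type) (X : Set) : Type :=
| Mem : X -> X -> formula C X
| Eq  : X -> X -> formula C X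
| In  : X -> C -> formula C X
| Bot : formula C X
| Imp : formula C X -> formula C X -> formula C X
| All : formula C (option X) -> formula C X.

Arguments Mem {C X} _ _.
Arguments Eq {C X} _ _.
Arguments In {C X} _ _.
Arguments Bot {C X}.
Arguments Imp {C X} _ _.
Arguments All {C X} _.

Definition set_formula (X : Set) : Type := formula Empty_set X.

Definition scons {D : Type} {X : Set} (x : D) (e : X -> D) : option X -> D :=
  fun i => match i with Some j => e j | None => x end.

Fixpoint sat (M : estruct) {C : Type} (A : C -> M -> Prop) {X : Set}
    (phi : formula C X) (e : X -> M) {struct phi} : Prop :=
  match phi with
  | Mem i j => e i ∈ e j
  | Eq i j => e i = e j
  | In i c => A c (e i)
  | Bot => False
  | Imp p q => sat M A p e -> sat M A q e
  | All p => forall x : M, sat M A p (scons x e)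
  end.

Definition holds (M : estruct) {X : Set} (phi : set_formula X) (e : X -> M) : Prop :=
  sat M (fun c : Empty_set => match c with end) phi e.

Definition true_in (M : estruct) (phi : set_formula Empty_set) : Prop :=
  holds M phi (fun i => match i with end).

Definition true_of (M : estruct) (phi : set_formula unit) (a : M) : Prop :=
  holds M phi (fun _ => a).

(** * Basic set-theoretic vocabulary *)

Definition subset {M : estruct} (x y : M) : Prop :=
  forall z : M, z ∈ x -> z ∈ y.

Definition is_succ {M : estruct} (s x : M) : Prop :=
  forall z : M, z ∈ s <-> z ∈ x \/ z = x.

(** Kuratowski pairs: [p = {{x}, {x, y}}]. *)
Definition is_pair {M : estruct} (p x y : M) : Prop :=
  forall z : M, z ∈ p <->
    (forall t : M, t ∈ z <-> t = x) \/ (forall t : M, t ∈ z <-> t = x \/ t = y).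

Definition app {M : estruct} (f x y : M) : Prop :=
  exists p : M, is_pair p x y /\ p ∈ f.

Definition class_app {M : estruct} (F : M -> Prop) (x y : M) : Prop :=
  exists p : M, is_pair p x y /\ F p.

Definition class_functional {M : estruct} (F : M -> Prop) : Prop :=
  forall x y y' : M, class_app F x y -> class_app F x y' -> y = y'.

(** [f] is a set of ordered pairs and a function with domain [d]. *)
Definition function_on {M : estruct} (f d : M) : Prop :=
  (forall p : M, p ∈ f -> exists x y : M, x ∈ d /\ is_pair p x y) /\
  (forall x : M, x ∈ d -> exists! y : M, app f x y).

Definition bijection {M : estruct} (f x y : M) : Prop :=
  function_on f x /\
  (forall u v : M, app f u v -> v ∈ y) /\
  (forall v : M, v ∈ y -> exists! u : M, app f u v).

Definition equipotent {M : estruct} (x y : M) : Prop :=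
  exists f : M, bijection f x y.

(** * Set-existence axioms *)

Definition Extensionality (M : estruct) : Prop :=
  forall x y : M, (forall z : M, z ∈ x <-> z ∈ y) -> x = y.

Definition Foundation (M : estruct) : Prop :=
  forall a : M, (exists x : M, x ∈ a) ->
    exists x : M, x ∈ a /\ forall y : M, y ∈ x -> ~ y ∈ a.

Definition Pairing (M : estruct) : Prop :=
  forall x y : M, exists p : M, forall z : M, z ∈ p <-> z = x \/ z = y.

Definition Union (M : estruct) : Prop :=
  forall a : M, exists u : M, forall z : M, z ∈ u <-> exists x : M, x ∈ a /\ z ∈ x.

Definition PowerSet (M : estruct) : Prop :=
  forall a : M, exists p : M, forall z : M, z ∈ p <-> subset z a.

Definition Infinity (M : estruct) : Prop :=
  exists w : M,
    (exists o : M, (forall z : M, ~ z ∈ o) /\ o ∈ w) /\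
    (forall x : M, x ∈ w -> exists s : M, is_succ s x /\ s ∈ w).

Definition Separation (M : estruct) : Prop :=
  forall (X : Set) (phi : set_formula (option X)) (e : X -> M) (a : M),
    exists b : M, forall x : M, x ∈ b <-> x ∈ a /\ holds M phi (scons x e).

Definition Replacement (M : estruct) : Prop :=
  forall (X : Set) (phi : set_formula (option (option X))) (e : X -> M) (a : M),
    let R x y := holds M phi (scons y (scons x e)) in
    (forall x y y' : M, x ∈ a -> R x y -> R x y' -> y = y') ->
    exists b : M, forall y : M, y ∈ b <-> exists x : M, x ∈ a /\ R x y.

(** Every family of nonempty pairwise disjoint sets has a transversal. *)
Definition Choice (M : estruct) : Prop :=
  forall a : M,
    (forall x : M, x ∈ a -> exists z : M, z ∈ x) ->
    (forall x y z : M, x ∈ a -> y ∈ a -> z ∈ x -> z ∈ y -> x = y) ->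
    exists c : M, forall x : M, x ∈ a -> exists! z : M, z ∈ x /\ z ∈ c.

Record ZFC (M : estruct) : Prop := {
  zfc_extensionality : Extensionality M;
  zfc_foundation : Foundation M;
  zfc_pairing : Pairing M;
  zfc_union : Union M;
  zfc_power_set : PowerSet M;
  zfc_infinity : Infinity M;
  zfc_separation : Separation M;
  zfc_replacement : Replacement M;
  zfc_choice : Choice M
}.

(** * Models of GBC *)

(** A second-order structure in the Henkin sense: [is_class] singles out the
    collections of sets that are classes of the structure. *)
Record class_struct : Type := ClassStruct {
  sets :> estruct;
  is_class : (sets -> Prop) -> Prop
}.

Definition ClassComprehension (V : class_struct) : Prop :=
  forall (C : Type) (A : C -> V -> Prop) (X : Set)
    (phi : formula C (option X)) (e : X -> V),
    (forall c : C, is_class V (A c)) ->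
    is_class V (fun x => sat V A phi (scons x e)).

Definition ClassFoundation (V : class_struct) : Prop :=
  forall A : V -> Prop, is_class V A -> (exists x : V, A x) ->
    exists x : V, A x /\ forall y : V, y ∈ x -> ~ A y.

Definition ClassReplacement (V : class_struct) : Prop :=
  forall F : V -> Prop, is_class V F -> class_functional F ->
    forall a : V, exists b : V, forall y : V,
      y ∈ b <-> exists x : V, x ∈ a /\ class_app F x y.

Definition GlobalChoice (V : class_struct) : Prop :=
  exists F : V -> Prop, is_class V F /\ class_functional F /\
    forall x : V, (exists z : V, z ∈ x) -> exists y : V, y ∈ x /\ class_app F x y.

(** Extensionality for classes is built into their representation as
    predicates. *)
Record GBC (V : class_struct) : Prop := {
  gbc_extensionality : Extensionality V;
  gbc_pairing : Pairing V;
  gbc_union : Union V;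
  gbc_power_set : PowerSet V;
  gbc_infinity : Infinity V;
  gbc_comprehension : ClassComprehension V;
  gbc_foundation : ClassFoundation V;
  gbc_replacement : ClassReplacement V;
  gbc_global_choice : GlobalChoice V
}.

(** * Ordinals, the cumulative hierarchy, measurable cardinals *)

Definition transitive {M : estruct} (x : M) : Prop :=
  forall y : M, y ∈ x -> subset y x.

(** A transitive set linearly ordered by membership; that the order is a
    well-order comes from Foundation. *)
Definition ordinal {M : estruct} (a : M) : Prop :=
  transitive a /\
  forall x y : M, x ∈ a -> y ∈ a -> x ∈ y \/ x = y \/ y ∈ x.

Definition limit_ordinal {M : estruct} (a : M) : Prop :=
  ordinal a /\ (exists x : M, x ∈ a) /\
  forall x : M, x ∈ a -> exists y : M, y ∈ a /\ x ∈ y.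

Definition is_omega {M : estruct} (w : M) : Prop :=
  limit_ordinal w /\ forall x : M, x ∈ w -> ~ limit_ordinal x.

Definition cardinal {M : estruct} (k : M) : Prop :=
  ordinal k /\ forall a : M, a ∈ k -> ~ equipotent a k.

Definition uncountable_cardinal {M : estruct} (k : M) : Prop :=
  cardinal k /\ exists w : M, is_omega w /\ w ∈ k.

(** The cardinality of [x] is smaller than the cardinal [k]. *)
Definition card_lt {M : estruct} (x k : M) : Prop :=
  exists a : M, a ∈ k /\ equipotent x a.

(** [v = V_a] for an ordinal [a]: [f] is the sequence [<V_b : b <= a>] given by
    the recursion V_b = union of the P(V_c) for c < b, which amounts to the
    zero, successor and limit clauses. *)
Definition is_V {M : estruct} (a v : M) : Prop :=
  exists f s : M, is_succ s a /\ function_on f s /\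
    (forall b y : M, app f b y ->
       forall x : M, x ∈ y <-> exists c z : M, c ∈ b /\ app f c z /\ subset x z) /\
    app f a v.

Definition in_V {M : estruct} (k a : M) : Prop :=
  exists v : M, is_V k v /\ a ∈ v.

Record ultrafilter_on {M : estruct} (U k : M) : Prop := {
  uf_subset : forall x : M, x ∈ U -> subset x k;
  uf_full : k ∈ U;
  uf_nonempty : forall x : M, x ∈ U -> exists z : M, z ∈ x;
  uf_upward : forall x y : M, x ∈ U -> subset x y -> subset y k -> y ∈ U;
  uf_inter : forall x y z : M, x ∈ U -> y ∈ U ->
    (forall t : M, t ∈ z <-> t ∈ x /\ t ∈ y) -> z ∈ U;
  uf_ultra : forall x y : M, subset x k ->
    (forall t : M, t ∈ y <-> t ∈ k /\ ~ t ∈ x) -> x ∈ U \/ y ∈ U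
}.

Definition principal {M : estruct} (U k : M) : Prop :=
  exists a : M, a ∈ k /\ forall x : M, x ∈ U <-> subset x k /\ a ∈ x.

(** Closed under the intersection, taken within [k], of fewer than [k]
    members. *)
Definition complete {M : estruct} (U k : M) : Prop :=
  forall F : M, subset F U -> card_lt F k ->
  forall z : M,
    (forall t : M, t ∈ z <-> t ∈ k /\ forall x : M, x ∈ F -> t ∈ x) -> z ∈ U.

Definition measurable {M : estruct} (k : M) : Prop :=
  uncountable_cardinal k /\
  exists U : M, ultrafilter_on U k /\ ~ principal U k /\ complete U k.

(** * Inner-model reflection *)

Record inner_model (V : class_struct) (W : V -> Prop) : Prop := {
  im_class : is_class V W;
  im_transitive : forall x y : V, W x -> y ∈ x -> W y;
  im_ordinals : forall a : V, ordinal a -> W a;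
  im_ZFC : ZFC (substruct V W)
}.

Definition proper (V : class_struct) (W : V -> Prop) : Prop :=
  exists x : V, ~ W x.

Definition reflection_with_parameters_in (V : class_struct) (P : V -> Prop) : Prop :=
  forall (phi : set_formula unit) (a : V), P a -> true_of V phi a ->
    exists W : V -> Prop, inner_model V W /\ proper V W /\
      exists Wa : W a, true_of (substruct V W) phi (exist W a Wa).

Definition lightface_reflection (V : class_struct) : Prop :=
  forall phi : set_formula Empty_set, true_in V phi ->
    exists W : V -> Prop, inner_model V W /\ proper V W /\
      true_in (substruct V W) phi.

Definition full_reflection (V : class_struct) : Prop :=
  reflection_with_parameters_in V (fun _ => True).

Definition proper_class_of_measurables (V : class_struct) : Prop :=
  ~ exists s : V, forall k : V, k ∈ s <-> measurable k.

(* Main.v *)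
(** If U is a nonprincipal k-complete ultrafilter on k, the ultrapower of V by U is well
    founded by countable completeness.  Its collapse W is a transitive class, and by Łoś's
    theorem the map j sending a to the class of the constant function a is elementary from
    V to W; so W satisfies ZFC, and it contains every ordinal a because a <= j(a).

    Call a set A small if every function from k to A is constant on a set in U.  Ordinals
    below k are small by completeness, and smallness passes to power sets and products, so
    V_a is small for a < k.  Hence j fixes V_k pointwise, and what V says about a parameter
    in V_k is true in W.

    W is not V: otherwise j(U) would be a measure on j(k) > k, for which k and hence the
    power set of k x k would be small, while choosing for every c < j(k) a function from
    k to k that represents c is an injection of j(k) into that power set.

    With a proper class of measurable cardinals every set lies in some such V_k. *)

(* [V] is a Henkin structure: a Rocq predicate on [V] need not be a class, and comprehension,
   replacement and foundation reach only what a formula defines. Every induction, recursion and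
   choice therefore carries a proof of definability. Two notions of it occur: one with classes as
   parameters, for reasoning in [V], and a pure one, for statements that Łoś's theorem transfers.

   Equivalence classes modulo U would be proper classes and are never formed. Every set counts as a
   function, through total application, and the collapse is a recursion on these functions along
   membership almost everywhere; that it identifies exactly the functions equal almost everywhere is
   proved afterwards.

   A common argument for W being proper shows that U is not in W. The argument used here makes j(U)
   a measure of V itself, so that the smallness lemmas, proved for an arbitrary measure, can be used
   a second time. *)
From Stdlib Require Import Classical ClassicalEpsilon FunctionalExtensionality
  PropExtensionality ProofIrrelevance.
Require Import Defs.

(** * Uniform definability *)

(** A formula is read in all structures of a frame at once.  The frame with the single
    structure [V] and the classes as predicates yields the classes of [V]; the frame
    [pure] of all structures yields the statements to which elementarity applies. *)
Record frame : Type := Frame {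
  index : Type;
  str : index -> estruct;
  prd : Type;
  ext : forall i, prd -> str i -> Prop
}.

Definition omap {X Y : Set} (f : X -> Y) (o : option X) : option Y :=
  match o with Some x => Some (f x) | None => None end.

Fixpoint rename {C : Type} {X Y : Set} (f : X -> Y) (phi : formula C X) : formula C Y :=
  match phi with
  | Mem i j => Mem (f i) (f j)
  | Eq i j => Eq (f i) (f j)
  | In i c => In (f i) c
  | Bot => Bot
  | Imp p q => Imp (rename f p) (rename f q)
  | All p => All (rename (omap f) p)
  end.

Lemma sat_rename (M : estruct) (C : Type) (A : C -> M -> Prop) (X : Set) (phi : formula C X) :
  forall (Y : Set) (f : X -> Y) (e : Y -> M),
  sat M A (rename f phi) e <-> sat M A phi (fun x => e (f x)).
Proof.
  induction phi as [X i j|X i j|X i c|X|X p IHp q IHq|X p IHp]; intros Y f e; simpl; try tauto.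
  - rewrite IHp, IHq. tauto.
  - assert (Hs : forall x, (fun o : option X => scons x e (omap f o))
                           = scons x (fun x => e (f x))).
    { intros x. apply functional_extensionality. now intros [y|]. }
    split; intros H x; specialize (H x).
    + rewrite <- Hs. now apply IHp in H.
    + apply IHp. now rewrite Hs.
Qed.

Section Definability.
Context (F : frame).

Definition definable {X : Set} (P : forall i, (X -> str F i) -> Prop) : Prop :=
  exists phi : formula (prd F) X, forall i e, sat (str F i) (ext F i) phi e <-> P i e.

(** The language has no function symbols, so a term is given by its definable graph, with the value
    in the new variable. *)
Definition term {X : Set} (t : forall i, (X -> str F i) -> str F i) : Prop :=
  @definable (option X) (fun i e => e None = t i (fun x => e (Some x))).

Lemma def_ext (X : Set) (P Q : forall i, (X -> str F i) -> Prop) :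
  definable Q -> (forall i e, P i e <-> Q i e) -> definable P.
Proof. intros [phi H] E. exists phi. intros i e. rewrite E. apply H. Qed.

Lemma def_imp (X : Set) (P Q : forall i, (X -> str F i) -> Prop) :
  definable P -> definable Q -> definable (fun i e => P i e -> Q i e).
Proof.
  intros [p Hp] [q Hq]. exists (Imp p q). intros i e. simpl. rewrite Hp, Hq. tauto.
Qed.

Lemma def_all (X : Set) (P : forall i, (X -> str F i) -> str F i -> Prop) :
  @definable (option X) (fun i e => P i (fun x => e (Some x)) (e None)) ->
  definable (fun i e => forall x, P i e x).
Proof.
  intros [p Hp]. exists (All p). intros i e. simpl.
  split; intros H x; specialize (H x); now apply Hp in H || apply Hp.
Qed.

Lemma def_bot (X : Set) : @definable X (fun _ _ => False).
Proof. now exists Bot. Qed.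

Lemma def_not (X : Set) (P : forall i, (X -> str F i) -> Prop) :
  definable P -> definable (fun i e => ~ P i e).
Proof. intros H. apply def_imp; [exact H|apply def_bot]. Qed.

Lemma def_and (X : Set) (P Q : forall i, (X -> str F i) -> Prop) :
  definable P -> definable Q -> definable (fun i e => P i e /\ Q i e).
Proof.
  intros HP HQ.
  apply def_ext with (fun i e => ~ (P i e -> ~ Q i e)).
  - apply def_not, def_imp, def_not; assumption.
  - intros i e. split; [tauto|]. intros H. split; apply NNPP; tauto.
Qed.

Lemma def_or (X : Set) (P Q : forall i, (X -> str F i) -> Prop) :
  definable P -> definable Q -> definable (fun i e => P i e \/ Q i e).
Proof.
  intros HP HQ.
  apply def_ext with (fun i e => ~ P i e -> Q i e).
  - apply def_imp; [apply def_not|]; assumption.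
  - intros i e. split; [tauto|]. intros H. destruct (classic (P i e)); tauto.
Qed.

Lemma def_iff (X : Set) (P Q : forall i, (X -> str F i) -> Prop) :
  definable P -> definable Q -> definable (fun i e => P i e <-> Q i e).
Proof. intros HP HQ. apply def_and; apply def_imp; assumption. Qed.

Lemma def_ex (X : Set) (P : forall i, (X -> str F i) -> str F i -> Prop) :
  @definable (option X) (fun i e => P i (fun x => e (Some x)) (e None)) ->
  definable (fun i e => exists x, P i e x).
Proof.
  intros H.
  apply def_ext with (fun i e => ~ forall x, ~ P i e x).
  - apply def_not, def_all, def_not, H.
  - intros i e. split.
    + intros [x Hx] K. exact (K x Hx).
    + apply not_all_not_ex.
Qed.

Lemma def_rename (X Y : Set) (f : X -> Y) (P : forall i, (X -> str F i) -> Prop) :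
  definable P -> definable (fun i (e : Y -> str F i) => P i (fun x => e (f x))).
Proof.
  intros [p Hp]. exists (rename f p). intros i e. rewrite sat_rename. apply Hp.
Qed.

Lemma term_var (X : Set) (x : X) : term (fun i e => e x).
Proof. exists (Eq None (Some x)). reflexivity. Qed.

Lemma term_rename (X Y : Set) (f : X -> Y) (t : forall i, (X -> str F i) -> str F i) :
  term t -> term (fun i (e : Y -> str F i) => t i (fun x => e (f x))).
Proof. exact (def_rename (option X) (option Y) (omap f) _). Qed.

(** The term is eliminated as a description: some x is its value and satisfies P. *)
Lemma def_term (X : Set) (P : forall i, (X -> str F i) -> str F i -> Prop)
    (t : forall i, (X -> str F i) -> str F i) :
  @definable (option X) (fun i e => P i (fun x => e (Some x)) (e None)) ->
  term t -> definable (fun i e => P i e (t i e)).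
Proof.
  intros HP Ht.
  apply def_ext with (fun i e => exists x, x = t i e /\ P i e x).
  - apply def_ex, def_and; assumption.
  - intros i e. split; [eauto|]. now intros (x & -> & H).
Qed.

Lemma def_eq (X : Set) (t s : forall i, (X -> str F i) -> str F i) :
  term t -> term s -> definable (fun i e => t i e = s i e).
Proof.
  intros Ht Hs.
  apply (def_term X (fun i e x => x = s i e)); assumption.
Qed.

Lemma def_mem (X : Set) (t s : forall i, (X -> str F i) -> str F i) :
  term t -> term s -> definable (fun i e => t i e ∈ s i e).
Proof.
  intros Ht Hs.
  apply (def_term X (fun i e x => x ∈ s i e)); [|assumption].
  apply (def_term (option X) (fun i e y => e None ∈ y)).
  - now exists (Mem (Some None) None).
  - exact (term_rename X (option X) Some s Hs).
Qed.

Lemma def_In (X : Set) (t : forall i, (X -> str F i) -> str F i) (c : prd F) :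
  term t -> definable (fun i e => ext F i c (t i e)).
Proof.
  intros Ht. apply (def_term X (fun i e x => ext F i c x)); [|assumption].
  now exists (In None c).
Qed.

(** The formula is fixed in the metatheory, so recursion on it builds the defining formula and no
    truth predicate is involved. This yields both substitution of terms and the definability of the
    instances of the axiom schemas. *)
Lemma def_sat (C : Type) (A : forall i, C -> str F i -> Prop) (X : Set) (phi : formula C X) :
  (forall c (Y : Set) (t : forall i, (Y -> str F i) -> str F i),
    term t -> definable (fun i e => A i c (t i e))) ->
  forall (Y : Set) (t : forall i, X -> (Y -> str F i) -> str F i),
  (forall x, term (fun i => t i x)) ->
  definable (fun i e => sat (str F i) (A i) phi (fun x => t i x e)).
Proof.
  intros HA.
  induction phi as [X i j|X i j|X i c|X|X p IHp q IHq|X p IHp]; intros Y t Ht; simpl.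
  - now apply (def_mem Y (fun k => t k i) (fun k => t k j)).
  - now apply (def_eq Y (fun k => t k i) (fun k => t k j)).
  - now apply (HA c Y (fun k => t k i)).
  - apply def_bot.
  - apply def_imp; auto.
  - apply def_all.
    apply (IHp (option Y) (fun i o e => match o with
                                        | Some x => t i x (fun y => e (Some y))
                                        | None => e None end)).
    intros [x|].
    + exact (term_rename Y (option Y) Some _ (Ht x)).
    + apply term_var.
Qed.

Lemma def_subst (X Y : Set) (P : forall i, (X -> str F i) -> Prop)
    (t : forall i, X -> (Y -> str F i) -> str F i) :
  definable P -> (forall x, term (fun i => t i x)) ->
  definable (fun i e => P i (fun x => t i x e)).
Proof.
  intros [p Hp] Ht.
  apply def_ext with (fun i e => sat (str F i) (ext F i) p (fun x => t i x e)).
  - apply def_sat; [|assumption]. intros c Z s. apply def_In.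
  - intros i e. now rewrite Hp.
Qed.

End Definability.

Ltac def_step :=
  cbv beta;
  lazymatch goal with
  | |- definable ?F (fun i e => @?P i e /\ @?Q i e) => apply (def_and F _ P Q)
  | |- definable ?F (fun i e => @?P i e \/ @?Q i e) => apply (def_or F _ P Q)
  | |- definable ?F (fun i e => @?P i e <-> @?Q i e) => apply (def_iff F _ P Q)
  | |- definable ?F (fun i e => ~ @?P i e) => apply (def_not F _ P)
  | |- definable ?F (fun i e => False) => apply (def_bot F)
  | |- definable ?F (fun i e => @?P i e -> @?Q i e) => apply (def_imp F _ P Q)
  | |- definable ?F (fun i e => forall x, @?P i e x) => apply (def_all F _ P)
  | |- definable ?F (fun i e => exists x, @?P i e x) => apply (def_ex F _ P)
  | |- definable ?F (fun i e => @?t i e = @?s i e) => apply (def_eq F _ t s)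
  | |- definable ?F (fun i e => @?t i e ∈ @?s i e) => apply (def_mem F _ t s)
  | |- term ?F (fun i e => e ?x) => apply (term_var F _ x)
  end.

(** * First-order expressibility of the axioms and of measures *)

Definition pure : frame :=
  Frame estruct (fun M => M) Empty_set (fun _ c => match c with end).

(** The part of measurability that is transported along j. Uncountability enters the ultrapower
    separately, through a set below k that is closed under successor. *)
Definition measure {M : estruct} (k U : M) : Prop :=
  ordinal k /\ ultrafilter_on U k /\ ~ principal U k /\ complete U k.

Lemma pure_holds (X Y : Set) (phi : set_formula X) (f : X -> Y) :
  definable pure (fun (M : estruct) (e : Y -> M) => holds M phi (fun x => e (f x))).
Proof.
  apply (def_rename pure X Y f (fun M e => holds M phi e)). exists phi. reflexivity.
Qed.

(** Elementarity speaks of one formula at a time, so the schema is treated instance by instance,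
    with the parameters as free variables and the given set in [None]. *)
Lemma pure_separation (X : Set) (phi : set_formula (option X)) :
  @definable pure (option X) (fun M e => exists b, forall x, x ∈ b <->
    x ∈ e None /\ holds M phi (scons x (fun i => e (Some i)))).
Proof.
  repeat def_step.
  apply def_ext with (fun (M : estruct) (e : option (option (option X)) -> M) =>
    holds M phi (fun o => e
      match o with Some i => Some (Some (Some i)) | None => None end)); [apply pure_holds|].
  intros M e. match goal with |- ?A <-> ?B => enough (A = B) as -> by reflexivity end.
  f_equal. apply functional_extensionality. now intros [i|].
Qed.

Lemma pure_replacement (X : Set) (phi : set_formula (option (option X))) :
  @definable pure (option X) (fun M e =>
    (forall x y y', x ∈ e None ->
      holds M phi (scons y (scons x (fun i => e (Some i)))) ->
      holds M phi (scons y' (scons x (fun i => e (Some i)))) -> y = y') ->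
    exists b, forall y, y ∈ b <-> exists x, x ∈ e None /\
      holds M phi (scons y (scons x (fun i => e (Some i))))).
Proof.
  assert (H : forall (Y : Set) (a b : Y) (f : X -> Y),
    definable pure (fun (M : estruct) (e : Y -> M) =>
      holds M phi (scons (e a) (scons (e b) (fun i => e (f i)))))).
  { intros Y a b f.
    apply def_ext with (fun (M : estruct) (e : Y -> M) => holds M phi (fun o => e
      match o with Some (Some i) => f i | Some None => b | None => a end));
      [apply pure_holds|].
    intros M e. match goal with |- ?A <-> ?B => enough (A = B) as -> by reflexivity end.
    f_equal. apply functional_extensionality. now intros [[i|]|]. }
  repeat def_step; apply H.
Qed.

Ltac purify := unfold Extensionality, Foundation, Pairing, Union, PowerSet, Infinity, Choice,
  complete, principal, card_lt, equipotent, bijection, function_on, app, is_pair, is_succ,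
  ordinal, transitive, subset, unique; repeat def_step.

(** Replaces the record by connectives and quantifiers, which [def_step] can follow. *)
Lemma ultrafilter_on_iff (M : estruct) (U k : M) : ultrafilter_on U k <->
  (forall x, x ∈ U -> subset x k) /\ k ∈ U /\
  (forall x, x ∈ U -> exists z, z ∈ x) /\
  (forall x y, x ∈ U -> subset x y -> subset y k -> y ∈ U) /\
  (forall x y z, x ∈ U -> y ∈ U -> (forall t, t ∈ z <-> t ∈ x /\ t ∈ y) -> z ∈ U) /\
  (forall x y, subset x k -> (forall t, t ∈ y <-> t ∈ k /\ ~ t ∈ x) -> x ∈ U \/ y ∈ U).
Proof. split; [intros []; tauto|]. intros (? & ? & ? & ? & ? & ?). now split. Qed.

Lemma pure_measure : @definable pure bool (fun M e => measure (e true) (e false)).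
Proof.
  unfold measure. repeat def_step; try solve [purify].
  apply def_ext with (2 := fun M e => ultrafilter_on_iff M (e false) (e true)).
  purify.
Qed.

(** * Sets and classes *)

Section UniverseOfSets.
Context (V : class_struct) (hV : GBC V).

Definition frm : frame :=
  Frame unit (fun _ => V) {A : V -> Prop | is_class V A} (fun _ c => proj1_sig c).

(** Quantifying over all terms that may be plugged in builds substitution into the notion, so that
    closure properties compose by proof search. *)
Definition def1 (P : V -> Prop) : Prop := forall (X : Set) (t : unit -> (X -> V) -> V),
  term frm t -> definable frm (fun i e => P (t i e)).
Definition def2 (P : V -> V -> Prop) : Prop :=
  forall (X : Set) (t s : unit -> (X -> V) -> V),
  term frm t -> term frm s -> definable frm (fun i e => P (t i e) (s i e)).
Definition fun1 (g : V -> V) : Prop := forall (X : Set) (t : unit -> (X -> V) -> V),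
  term frm t -> term frm (fun i e => g (t i e)).
Definition fun2 (g : V -> V -> V) : Prop :=
  forall (X : Set) (t s : unit -> (X -> V) -> V),
  term frm t -> term frm s -> term frm (fun i e => g (t i e) (s i e)).

Lemma class_definable (P : V -> Prop) :
  @definable frm (option Empty_set) (fun _ e => P (e None)) -> is_class V P.
Proof.
  intros [phi H].
  assert (K := gbc_comprehension V hV _ (fun c => proj1_sig c) Empty_set phi
                 (fun i => match i with end) (fun c => proj2_sig c)).
  replace P with (fun x => sat V (fun c : {A | is_class V A} => proj1_sig c) phi
                    (scons x (fun i : Empty_set => match i with end))); [exact K|].
  apply functional_extensionality. intros x. apply propositional_extensionality.
  exact (H tt (scons x (fun i : Empty_set => match i with end))).
Qed.

Lemma class_of_def1 (P : V -> Prop) : def1 P -> is_class V P.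
Proof. intros H. apply class_definable, (H _ (fun _ e => e None)), term_var. Qed.

Lemma def1_class (P : V -> Prop) : is_class V P -> def1 P.
Proof. intros H X t Ht. exact (def_In frm X t (exist _ P H) Ht). Qed.

(** The case distinction takes place outside the language: the defining formula is one for truth or
    one for falsity. *)
Lemma def_const (X : Set) (P : Prop) : @definable frm X (fun _ _ => P).
Proof.
  destruct (classic P).
  - apply def_ext with (fun _ _ => False -> False); [apply def_imp; apply def_bot|tauto].
  - apply def_ext with (fun _ _ => False); [apply def_bot|tauto].
Qed.

Lemma ext_eq (x y : V) : (forall z, z ∈ x <-> z ∈ y) -> x = y.
Proof. exact (gbc_extensionality V hV x y). Qed.

Definition is_set (P : V -> Prop) : Prop := exists s : V, forall x, x ∈ s <-> P x.

Lemma inhabited_V : inhabited V.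
Proof. destruct (gbc_infinity V hV) as [w _]. exact (inhabits w). Qed.

(** An arbitrary set if P has no extension that is a set. *)
Definition setof (P : V -> Prop) : V :=
  epsilon inhabited_V (fun s => forall x, x ∈ s <-> P x).

Lemma mem_setof (P : V -> Prop) : is_set P -> forall x, x ∈ setof P <-> P x.
Proof. exact (epsilon_spec inhabited_V (fun s => forall x, x ∈ s <-> P x)). Qed.

Lemma eq_setof (P : V -> Prop) (y : V) :
  is_set P -> (y = setof P <-> forall x, x ∈ y <-> P x).
Proof.
  intros H. split.
  - intros ->. now apply mem_setof.
  - intros K. apply ext_eq. intros z. now rewrite K, mem_setof.
Qed.

Lemma is_set_pair (x y : V) : is_set (fun z => z = x \/ z = y).
Proof. exact (gbc_pairing V hV x y). Qed.

Definition upair (x y : V) : V := setof (fun z => z = x \/ z = y).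
Lemma mem_upair (x y z : V) : z ∈ upair x y <-> z = x \/ z = y.
Proof. apply (mem_setof (fun z => z = x \/ z = y)), is_set_pair. Qed.

Definition pr (x y : V) : V := upair (upair x x) (upair x y).

Lemma is_pair_pr (p x y : V) : is_pair p x y <-> p = pr x y.
Proof.
  assert (E1 : forall z, z = upair x x <-> forall t, t ∈ z <-> t = x).
  { intros z. split.
    - intros -> t. rewrite mem_upair. tauto.
    - intros H. apply ext_eq. intros t. rewrite H, mem_upair. tauto. }
  assert (E2 : forall z, z = upair x y <-> forall t, t ∈ z <-> t = x \/ t = y).
  { intros z. split.
    - intros -> t. apply mem_upair.
    - intros H. apply ext_eq. intros t. now rewrite H, mem_upair. }
  split.
  - intros H. apply ext_eq. intros z. unfold pr. rewrite (H z), mem_upair, E1, E2. tauto.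
  - intros -> z. unfold pr. rewrite mem_upair, E1, E2. tauto.
Qed.

Lemma pr_inj (x y x' y' : V) : pr x y = pr x' y' -> x = x' /\ y = y'.
Proof.
  intros E.
  assert (H : forall z, z = upair x x \/ z = upair x y <-> z = upair x' x' \/ z = upair x' y').
  { intros z. rewrite <- !mem_upair. unfold pr in E. now rewrite E. }
  assert (Ex : x = x').
  { assert (K : upair x' x' = upair x x \/ upair x' x' = upair x y) by (apply H; tauto).
    assert (x ∈ upair x' x') as M by (destruct K as [-> | ->]; apply mem_upair; tauto).
    apply mem_upair in M. tauto. }
  subst x'. split; [reflexivity|].
  assert (A : y = x \/ y = y').
  { assert (K : upair x y = upair x x \/ upair x y = upair x y') by (apply H; tauto).
    assert (M : y ∈ upair x y) by (apply mem_upair; tauto).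
    destruct K as [K|K]; rewrite K in M; apply mem_upair in M; tauto. }
  assert (B : y' = x \/ y' = y).
  { assert (K : upair x y' = upair x x \/ upair x y' = upair x y) by (apply H; tauto).
    assert (M : y' ∈ upair x y') by (apply mem_upair; tauto).
    destruct K as [K|K]; rewrite K in M; apply mem_upair in M; tauto. }
  destruct A, B; congruence.
Qed.

(** Formulas of a frame have class parameters only; the set parameter p enters through the class
    whose sole member is p. *)
Lemma term_const (X : Set) (p : V) : @term frm X (fun _ _ => p).
Proof.
  assert (is_class V (fun x => x = p)) as Hp.
  { assert (K := gbc_comprehension V hV Empty_set (fun c => match c with end) unit
                   (Eq None (Some tt)) (fun _ => p) (fun c => match c with end)).
    exact K. }
  exact (def1_class _ Hp (option X) _ (term_var frm _ None)).
Qed.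

Lemma term_setof (X : Set) (P : unit -> (X -> V) -> V -> Prop) :
  (forall i e, is_set (P i e)) ->
  @definable frm (option X) (fun i e => P i (fun x => e (Some x)) (e None)) ->
  term frm (fun i e => setof (P i e)).
Proof.
  intros Hs HP. unfold term.
  apply def_ext with (fun i e => forall x, x ∈ e None <-> P i (fun x => e (Some x)) x).
  - apply (def_all frm _ (fun i e x => x ∈ e None <-> P i (fun y => e (Some y)) x)).
    apply def_iff; [apply (def_mem frm); apply term_var|].
    exact (def_rename frm _ _ (omap Some) _ HP).
  - intros i e. now rewrite eq_setof.
Qed.

Lemma term_subst (X Y : Set) (t : unit -> (X -> V) -> V) (s : unit -> X -> (Y -> V) -> V) :
  term frm t -> (forall x, term frm (fun i => s i x)) ->
  term frm (fun i e => t i (fun x => s i x e)).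
Proof.
  intros Ht Hs.
  apply (def_subst frm (option X) (option Y) (fun i e => e None = t i (fun x => e (Some x)))
    (fun i o e => match o with Some x => s i x (fun y => e (Some y)) | None => e None end));
    [exact Ht|].
  intros [x|]; [|apply (term_var frm)].
  exact (term_rename frm Y (option Y) Some _ (Hs x)).
Qed.

(** Freezing the environment turns its values into parameters. *)
Lemma fun1_of_term (X : Set) (g : unit -> (X -> V) -> V -> V) :
  @term frm (option X) (fun i e => g i (fun x => e (Some x)) (e None)) ->
  forall i e, fun1 (g i e).
Proof.
  intros Hg [] e Y t Ht.
  assert (K := term_subst _ Y _ (fun i o e' => match o with Some x => e x | None => t i e' end) Hg).
  simpl in K.
  assert (K' : term frm (fun i e' => g i (fun x => e x) (t i e'))).
  { apply K. intros [x|]; [apply term_const|exact Ht]. }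
  refine (def_ext frm _ _ _ K' _). intros [] e'. reflexivity.
Qed.

Lemma fun2_upair : fun2 upair.
Proof.
  intros X t s Ht Hs. apply term_setof; [intros; apply is_set_pair|].
  apply def_or; (apply def_eq; [apply term_var|]).
  - exact (term_rename frm X (option X) Some t Ht).
  - exact (term_rename frm X (option X) Some s Hs).
Qed.

Lemma fun2_pr : fun2 pr.
Proof. intros X t s Ht Hs. apply fun2_upair; apply fun2_upair; assumption. Qed.

Create HintDb dfn discriminated.
#[local] Hint Resolve fun2_upair fun2_pr : dfn.

Ltac dfn_arg_step :=
  lazymatch goal with
  | H : term _ ?t |- term _ ?t => exact H
  | H : definable _ ?t |- definable _ ?t => exact H
  | H : term _ ?t |- term _ (fun i e => ?t i (fun x => e (@?f x))) =>
      exact (term_rename frm _ _ f t H)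
  | H : definable _ ?t |- definable _ (fun i e => ?t i (fun x => e (@?f x))) =>
      exact (def_rename frm _ _ f t H)
  | H : term _ (fun i e => ?g i (fun x => e (Some x)) (e None))
    |- term _ (fun i e => ?g i (fun x => e (@?f x)) (e ?y)) =>
      exact (term_rename frm _ _ (fun o => match o with Some x => f x | None => y end) _ H)
  end.

Ltac dfn_known :=
  match goal with
  | |- definable _ (fun i e => ?P (@?t i e) (@?s i e)) =>
      let H := fresh in
      assert (H : def2 P) by (solve [auto with dfn nocore]); apply (H _ t s); clear H
  | |- definable _ (fun i e => ?P (@?t i e)) =>
      let H := fresh in
      assert (H : def1 P) by (solve [auto with dfn nocore]); apply (H _ t); clear H
  | |- term _ (fun i e => ?P (@?t i e) (@?s i e)) =>
      let H := fresh in
      assert (H : fun2 P) by (solve [auto with dfn nocore]); apply (H _ t s); clear H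
  | |- term _ (fun i e => ?P (@?t i e)) =>
      let H := fresh in
      assert (H : fun1 P) by (solve [auto with dfn nocore]); apply (H _ t); clear H
  end.

(** A hook for operators with a function argument, such as [image] and [lam], which the hint
    database for [fun1] and [fun2] does not cover. *)
Ltac dfn_operator := fail.

Ltac dfn_step :=
  cbv beta;
  first [ apply def_const | apply term_const | dfn_arg_step | def_step | dfn_operator | dfn_known ].
Ltac dfn := intros; try match goal with
  | |- def1 _ => intros ? ? ? | |- def2 _ => intros ? ? ? ? ?
  | |- fun1 _ => intros ? ? ? | |- fun2 _ => intros ? ? ? ? ? end;
  repeat dfn_step.

(** * Replacement, separation and functions as sets *)

Lemma app_pr (f x y : V) : app f x y <-> pr x y ∈ f.
Proof.
  split.
  - intros (p & Hp & Hf). apply is_pair_pr in Hp. now subst p.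
  - intros H. exists (pr x y). split; [now apply is_pair_pr|exact H].
Qed.

Lemma class_app_pr (F : V -> Prop) (x y : V) : class_app F x y <-> F (pr x y).
Proof.
  split.
  - intros (p & Hp & Hf). apply is_pair_pr in Hp. now subst p.
  - intros H. exists (pr x y). split; [now apply is_pair_pr|exact H].
Qed.

Lemma is_set_replace (a : V) (R : V -> V -> Prop) : def2 R ->
  (forall x y y', x ∈ a -> R x y -> R x y' -> y = y') ->
  is_set (fun y => exists x, x ∈ a /\ R x y).
Proof.
  intros HR Hf.
  (* Restricting R to arguments in a makes it functional everywhere, as [ClassReplacement]
     demands. *)
  set (F := fun p => exists x y, p = pr x y /\ x ∈ a /\ R x y).
  assert (HF : forall x y, class_app F x y <-> x ∈ a /\ R x y).
  { intros x y. rewrite class_app_pr. split.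
    - intros (x' & y' & E & H). apply pr_inj in E. now destruct E as [-> ->].
    - intros H. now exists x, y. }
  destruct (gbc_replacement V hV F) with (a := a) as [b Hb].
  - apply class_of_def1. unfold F. dfn.
  - intros x y y' H H'. apply HF in H, H'. apply (Hf x); tauto.
  - exists b. intros y. rewrite Hb. split; intros (x & Hx); exists x; rewrite HF in *; tauto.
Qed.

Lemma is_set_sub (Q P : V -> Prop) :
  is_set Q -> def1 P -> (forall x, P x -> Q x) -> is_set P.
Proof.
  intros [a Ha] HP HQ.
  (* Separation is replacement along the identity restricted to P. *)
  destruct (is_set_replace a (fun x y => x = y /\ P x)) as [b Hb].
  - dfn.
  - intros x y y' _ [<- _] [<- _]. reflexivity.
  - exists b. intros x. rewrite Hb. split.
    + now intros (y & _ & <- & H).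
    + intros H. exists x. split; [now apply Ha, HQ|tauto].
Qed.

Lemma is_set_mem (a : V) : is_set (fun x => x ∈ a).
Proof. exists a. reflexivity. Qed.

Lemma is_set_sep (a : V) (P : V -> Prop) : def1 P -> is_set (fun x => x ∈ a /\ P x).
Proof. intros HP. apply (is_set_sub (fun x => x ∈ a)); [apply is_set_mem|dfn|tauto]. Qed.

Lemma is_set_image (a : V) (g : V -> V) :
  fun1 g -> is_set (fun y => exists x, x ∈ a /\ y = g x).
Proof. intros Hg. apply is_set_replace; [dfn|congruence]. Qed.

Definition bigU (a : V) : V := setof (fun z => exists x, x ∈ a /\ z ∈ x).
Lemma mem_bigU (a z : V) : z ∈ bigU a <-> exists x, x ∈ a /\ z ∈ x.
Proof. apply (mem_setof (fun z => exists x, x ∈ a /\ z ∈ x)), (gbc_union V hV). Qed.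
Lemma fun1_bigU : fun1 bigU.
Proof.
  intros X t Ht. apply term_setof; [intros; apply (gbc_union V hV)|]. repeat dfn_step.
Qed.
#[local] Hint Resolve fun1_bigU : dfn.

Lemma def2_subset : def2 subset.
Proof. unfold subset. dfn. Qed.
#[local] Hint Resolve def2_subset : dfn.

Definition pow (a : V) : V := setof (fun z => subset z a).
Lemma mem_pow (a z : V) : z ∈ pow a <-> subset z a.
Proof. apply (mem_setof (fun z => subset z a)), (gbc_power_set V hV). Qed.
Lemma fun1_pow : fun1 pow.
Proof.
  intros X t Ht. apply term_setof; [intros; apply (gbc_power_set V hV)|]. repeat dfn_step.
Qed.
#[local] Hint Resolve fun1_pow : dfn.

Definition image (g : V -> V) (a : V) : V := setof (fun y => exists x, x ∈ a /\ y = g x).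
Lemma mem_image (g : V -> V) (a y : V) :
  fun1 g -> (y ∈ image g a <-> exists x, x ∈ a /\ y = g x).
Proof. intros H. now apply (mem_setof (fun y => exists x, x ∈ a /\ y = g x)), is_set_image. Qed.
Lemma term_image (X : Set) (g : unit -> (X -> V) -> V -> V) (t : unit -> (X -> V) -> V) :
  @term frm (option X) (fun i e => g i (fun x => e (Some x)) (e None)) -> term frm t ->
  term frm (fun i e => image (g i e) (t i e)).
Proof.
  intros Hg Ht. apply term_setof.
  - intros i e. apply is_set_image. exact (fun1_of_term X g Hg i e).
  - repeat dfn_step.
Qed.

Ltac dfn_operator ::= lazymatch goal with
  | |- term _ (fun i e => image (@?g i e) (@?t i e)) => apply (term_image _ g t)
  end.

Lemma image_ext (g h : V -> V) (a : V) :
  (forall x, x ∈ a -> g x = h x) -> image g a = image h a.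
Proof.
  intros E. unfold image. f_equal. apply functional_extensionality. intros y.
  apply propositional_extensionality.
  split; intros (x & Hx & ->); exists x; rewrite E; auto.
Qed.

Definition single (x : V) : V := upair x x.
Lemma mem_single (x z : V) : z ∈ single x <-> z = x.
Proof. unfold single. rewrite mem_upair. tauto. Qed.

Definition union (a b : V) : V := bigU (upair a b).
Lemma mem_union (a b z : V) : z ∈ union a b <-> z ∈ a \/ z ∈ b.
Proof.
  unfold union. rewrite mem_bigU. split.
  - intros (x & Hx & Hz). apply mem_upair in Hx. destruct Hx; subst; tauto.
  - intros [H|H]; [exists a|exists b]; rewrite mem_upair; tauto.
Qed.
Lemma fun2_union : fun2 union.
Proof. unfold union. dfn. Qed.

Definition succ (x : V) : V := union x (single x).
Lemma mem_succ (x z : V) : z ∈ succ x <-> z ∈ x \/ z = x.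
Proof. unfold succ. now rewrite mem_union, mem_single. Qed.
Lemma fun1_single : fun1 single.
Proof. unfold single. dfn. Qed.
#[local] Hint Resolve fun2_union fun1_single : dfn.
Lemma fun1_succ : fun1 succ.
Proof. unfold succ. dfn. Qed.
#[local] Hint Resolve fun1_succ : dfn.

Definition prod (a b : V) : V := bigU (image (fun x => image (pr x) b) a).
Lemma mem_prod (a b p : V) : p ∈ prod a b <-> exists x y, x ∈ a /\ y ∈ b /\ p = pr x y.
Proof.
  unfold prod. rewrite mem_bigU. split.
  - intros (s & Hs & Hp).
    apply mem_image in Hs; [|dfn].
    destruct Hs as (x & Hx & ->).
    apply mem_image in Hp; [|dfn]. destruct Hp as (y & Hy & ->). now exists x, y.
  - intros (x & y & Hx & Hy & ->). exists (image (pr x) b). split.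
    + apply mem_image; [dfn|eauto].
    + apply mem_image; [dfn|eauto].
Qed.
Lemma fun2_prod : fun2 prod.
Proof. unfold prod. dfn. Qed.
#[local] Hint Resolve fun2_prod : dfn.

(** Total application: every set acts as a function, which sends a point
    outside its domain to the empty set. *)
Definition ap (f x : V) : V := setof (fun z => exists y, pr x y ∈ f /\ z ∈ y).
Lemma is_set_ap (f x : V) : is_set (fun z => exists y, pr x y ∈ f /\ z ∈ y).
Proof.
  apply (is_set_sub (fun z => z ∈ bigU (bigU (bigU f)))); [apply is_set_mem|dfn|].
  intros z (y & Hy & Hz). rewrite mem_bigU. exists y. split; [|exact Hz].
  rewrite mem_bigU. exists (upair x y). split; [|rewrite mem_upair; tauto].
  rewrite mem_bigU. exists (pr x y). split; [exact Hy|]. apply mem_upair. tauto.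
Qed.
Lemma mem_ap (f x z : V) : z ∈ ap f x <-> exists y, pr x y ∈ f /\ z ∈ y.
Proof. apply (mem_setof (fun z => exists y, pr x y ∈ f /\ z ∈ y)), is_set_ap. Qed.
Lemma fun2_ap : fun2 ap.
Proof. intros X t s Ht Hs. apply term_setof; [intros; apply is_set_ap|]. repeat dfn_step. Qed.
#[local] Hint Resolve fun2_ap : dfn.

Lemma ap_eq (f x y : V) : pr x y ∈ f -> (forall y', pr x y' ∈ f -> y' = y) -> ap f x = y.
Proof.
  intros H U. apply ext_eq. intros z. rewrite mem_ap. split.
  - intros (y' & Hy & Hz). now rewrite <- (U y' Hy).
  - eauto.
Qed.

(** In the chain z ∈ y ∈ {x, y} ∈ [pr x y] ∈ f there are three unions to take. The bound does not
    depend on x and later confines the representatives in [pred_ae]. *)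
Lemma mem_ap_bigU (f x z : V) : z ∈ ap f x -> z ∈ bigU (bigU (bigU f)).
Proof.
  rewrite mem_ap. intros (y & Hy & Hz). rewrite mem_bigU. exists y. split; [|exact Hz].
  rewrite mem_bigU. exists (upair x y). split; [|rewrite mem_upair; tauto].
  rewrite mem_bigU. exists (pr x y). split; [exact Hy|]. apply mem_upair. tauto.
Qed.

Definition lam (a : V) (g : V -> V) : V := image (fun x => pr x (g x)) a.
Lemma mem_lam (a : V) (g : V -> V) (p : V) :
  fun1 g -> (p ∈ lam a g <-> exists x, x ∈ a /\ p = pr x (g x)).
Proof. intros Hg. apply mem_image. dfn. Qed.
Lemma pr_mem_lam (a : V) (g : V -> V) (x y : V) :
  fun1 g -> (pr x y ∈ lam a g <-> x ∈ a /\ y = g x).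
Proof.
  intros Hg. rewrite mem_lam by assumption. split.
  - intros (x' & Hx & E). apply pr_inj in E. now destruct E as [-> ->].
  - intros [Hx ->]. eauto.
Qed.
Lemma ap_lam (a : V) (g : V -> V) (x : V) : fun1 g -> x ∈ a -> ap (lam a g) x = g x.
Proof.
  intros Hg Hx. apply ap_eq.
  - now apply pr_mem_lam.
  - intros y'. rewrite pr_mem_lam by assumption. tauto.
Qed.
Lemma term_lam (X : Set) (g : unit -> (X -> V) -> V -> V) (t : unit -> (X -> V) -> V) :
  @term frm (option X) (fun i e => g i (fun x => e (Some x)) (e None)) -> term frm t ->
  term frm (fun i e => lam (t i e) (g i e)).
Proof.
  intros Hg Ht. unfold lam. repeat dfn_step.
Qed.
Ltac dfn_operator ::= lazymatch goal with
  | |- term _ (fun i e => image (@?g i e) (@?t i e)) => apply (term_image _ g t)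
  | |- term _ (fun i e => lam (@?t i e) (@?g i e)) => apply (term_lam _ g t)
  end.

(** * Foundation and induction on membership *)

Lemma mem_minimal (P : V -> Prop) :
  def1 P -> (exists x, P x) -> exists x, P x /\ forall y, y ∈ x -> ~ P y.
Proof. intros HP. now apply (gbc_foundation V hV P), class_of_def1. Qed.

Lemma mem_induction (P : V -> Prop) :
  def1 P -> (forall x, (forall y, y ∈ x -> P y) -> P x) -> forall x, P x.
Proof.
  intros HP IH x. apply NNPP. intros Hx.
  destruct (mem_minimal (fun x => ~ P x)) as (m & Hm & K); [dfn|eauto|].
  apply Hm, IH. intros y Hy. apply NNPP, K, Hy.
Qed.

Lemma mem_irrefl (x : V) : ~ x ∈ x.
Proof.
  revert x. apply mem_induction; [dfn|]. intros x IH H. exact (IH x H H).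
Qed.
Lemma mem_asym (x y : V) : x ∈ y -> ~ y ∈ x.
Proof.
  revert x y. apply (mem_induction (fun x => forall y, x ∈ y -> ~ y ∈ x)); [dfn|].
  intros x IH y Hxy Hyx. exact (IH y Hyx x Hyx Hxy).
Qed.

Lemma succ_inj (x y : V) : succ x = succ y -> x = y.
Proof.
  intros E. assert (Hx : x ∈ succ y) by (rewrite <- E; apply mem_succ; tauto).
  assert (Hy : y ∈ succ x) by (rewrite E; apply mem_succ; tauto).
  apply mem_succ in Hx, Hy. destruct Hx as [Hx|], Hy as [Hy|]; auto.
  destruct (mem_asym x y Hx Hy).
Qed.

(** * Recursion *)

Definition well_founded_class (R : V -> V -> Prop) : Prop :=
  forall P : V -> Prop, def1 P -> (forall x, (forall y, R y x -> P y) -> P x) -> forall x, P x.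

Section Recursion.
Context (R : V -> V -> Prop) (HR : def2 R) (Rset : forall x, is_set (fun y => R y x))
  (Rwf : well_founded_class R) (G : V -> V -> V) (HG : fun2 G).
#[local] Hint Resolve HR HG : dfn.

Let pred (x : V) : V := setof (fun y => R y x).
Let mem_pred (x y : V) : y ∈ pred x <-> R y x.
Proof. exact (mem_setof (fun y => R y x) (Rset x) y). Qed.
Let fun1_pred : fun1 pred.
Proof.
  intros X t Ht. apply (term_setof _ (fun i e y => R y (t i e))); [intros; apply Rset|].
  repeat dfn_step.
Qed.
#[local] Hint Resolve fun1_pred : dfn.

Let closed (d : V) : Prop := forall y z, y ∈ d -> R z y -> z ∈ d.
Let in_closure (x z : V) : Prop := forall d, x ∈ d -> closed d -> z ∈ d.
Let def1_closed : def1 closed.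
Proof. unfold closed. dfn. Qed.
#[local] Hint Resolve def1_closed : dfn.
Let def2_in_closure : def2 in_closure.
Proof. unfold in_closure. dfn. Qed.
#[local] Hint Resolve def2_in_closure : dfn.

(** [in_closure] is an intersection of closed sets, which describes a set only once some closed set
    contains x. One is obtained from x and the closures of its predecessors, which are sets by
    induction. *)
Let closed_superset (x : V) : exists d, x ∈ d /\ closed d.
Proof.
  revert x. apply Rwf; [dfn|]. intros x IH.
  (* The closure is not yet known to exist for every y, so replacement uses the relation that c is
     the closure of y. *)
  destruct (is_set_replace (pred x) (fun y c => forall z, z ∈ c <-> in_closure y z))
    as [C HC].
  - dfn.
  - intros y c c' _ H H'. apply ext_eq. intros z. now rewrite H, H'.
  - exists (union (bigU C) (single x)). split; [rewrite mem_union, mem_single; tauto|].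
    assert (K : forall y z, R y x -> in_closure y z -> z ∈ bigU C).
    { intros y z Hy Hz.
      destruct (IH y Hy) as (d & Hd & Hd').
      destruct (is_set_sub (fun z => z ∈ d) (in_closure y)) as [c Hc].
      - apply is_set_mem.
      - dfn.
      - intros z' Hz'. now apply Hz'.
      - apply mem_bigU. exists c. split; [|now apply Hc].
        apply HC. exists y. split; [now apply mem_pred|exact Hc]. }
    intros y z Hy Hz. apply mem_union. left. apply mem_union in Hy. destruct Hy as [Hy|Hy].
    + apply mem_bigU in Hy. destruct Hy as (c & Hc & Hy).
      apply HC in Hc. destruct Hc as (u & Hu & Hc). apply mem_pred in Hu.
      apply (K u); [exact Hu|]. intros d Hd Hd'. apply (Hd' y z); [|exact Hz].
      apply Hc in Hy. now apply Hy.
    + apply mem_single in Hy. subst y. apply (K z); [exact Hz|]. now intros d Hd _.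
Qed.

Let is_set_closure (x : V) : is_set (in_closure x).
Proof.
  destruct (closed_superset x) as (d & Hd & Hd').
  apply (is_set_sub (fun z => z ∈ d)); [apply is_set_mem|dfn|].
  intros z Hz. now apply Hz.
Qed.

Let cl (x : V) : V := setof (in_closure x).
Let mem_cl (x z : V) : z ∈ cl x <-> in_closure x z.
Proof. exact (mem_setof (in_closure x) (is_set_closure x) z). Qed.
Let fun1_cl : fun1 cl.
Proof.
  intros X t Ht. apply (term_setof _ (fun i e => in_closure (t i e)));
    [intros; apply is_set_closure|]. repeat dfn_step.
Qed.
#[local] Hint Resolve fun1_cl : dfn.
Let cl_self (x : V) : x ∈ cl x.
Proof. apply mem_cl. now intros d Hd _. Qed.
Let cl_closed (x : V) : closed (cl x).
Proof.
  intros y z Hy Hz. apply mem_cl. intros d Hd Hd'. apply (Hd' y); [|exact Hz].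
  apply mem_cl in Hy. now apply Hy.
Qed.
Let cl_sub (x y d : V) : closed d -> x ∈ d -> y ∈ cl x -> y ∈ d.
Proof. intros Hd Hx Hy. apply mem_cl in Hy. now apply Hy. Qed.

(** A partial solution of the recursion equation. Only the values of p on d matter; p may contain
    anything else. *)
Let attempt (d p : V) : Prop := forall y, y ∈ d -> ap p y = G y (image (ap p) (pred y)).
Let def2_attempt : def2 attempt.
Proof. unfold attempt. dfn. Qed.
#[local] Hint Resolve def2_attempt : dfn.

Let attempt_unique (d p q : V) : closed d -> attempt d p -> attempt d q ->
  forall y, y ∈ d -> ap p y = ap q y.
Proof.
  intros Hd Hp Hq. apply (Rwf (fun y => y ∈ d -> ap p y = ap q y)); [dfn|].
  intros y IH Hy. rewrite (Hp y Hy), (Hq y Hy). f_equal. apply image_ext.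
  intros z Hz. apply mem_pred in Hz. apply IH; [exact Hz|]. exact (Hd y z Hy Hz).
Qed.

Let attempt_mono (d d' p : V) : (forall x, x ∈ d -> x ∈ d') -> attempt d' p -> attempt d p.
Proof. intros H A y Hy. apply A, H, Hy. Qed.

Let has_value (z v : V) : Prop := exists p, attempt (cl z) p /\ v = ap p z.
Let def2_has_value : def2 has_value.
Proof. unfold has_value. dfn. Qed.
#[local] Hint Resolve def2_has_value : dfn.
Let has_value_unique (z v w : V) : has_value z v -> has_value z w -> v = w.
Proof.
  intros (p & Hp & ->) (q & Hq & ->).
  apply (attempt_unique (cl z)); auto.
Qed.

Let attempt_exists (x : V) : exists p, attempt (cl x) p.
Proof.
  revert x. apply Rwf; [dfn|]. intros x IH.
  set (D := bigU (image cl (pred x))).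
  assert (HD : forall z, z ∈ D <-> exists y, R y x /\ z ∈ cl y).
  { intros z. unfold D. rewrite mem_bigU. split.
    - intros (c & Hc & Hz). apply mem_image in Hc; [|dfn]. destruct Hc as (y & Hy & ->).
      exists y. split; [now apply mem_pred|exact Hz].
    - intros (y & Hy & Hz). exists (cl y). split; [|exact Hz].
      apply mem_image; [dfn|]. exists y. split; [now apply mem_pred|reflexivity]. }
  assert (Dcl : closed D).
  { intros y z Hy Hz. apply HD in Hy. destruct Hy as (u & Hu & Hy). apply HD.
    exists u. split; [exact Hu|]. exact (cl_closed u y z Hy Hz). }
  assert (Hval : forall z, z ∈ D -> exists p, attempt (cl z) p).
  { intros z Hz. apply HD in Hz. destruct Hz as (y & Hy & Hz).
    destruct (IH y Hy) as [p Hp]. exists p. apply (attempt_mono _ (cl y)); [|exact Hp].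
    intros u Hu. apply (cl_sub z); auto. }
  (* The set q glues together the values of all attempts at points of D, where uniqueness makes them
     agree. *)
  destruct (is_set_replace D (fun z w => exists v, has_value z v /\ w = pr z v)) as [q Hq].
  { dfn. }
  { intros z w w' _ (v & Hv & ->) (v' & Hv' & ->). now rewrite (has_value_unique z v v'). }
  assert (apq : forall z p, z ∈ D -> attempt (cl z) p -> ap q z = ap p z).
  { intros z p Hz Hp. apply ap_eq.
    - apply Hq. exists z. split; [exact Hz|]. exists (ap p z). split; [|reflexivity].
      now exists p.
    - intros v Hv. apply Hq in Hv. destruct Hv as (z' & _ & w & Hw & E).
      apply pr_inj in E. destruct E as [<- <-].
      apply (has_value_unique z); [exact Hw|now exists p]. }
  assert (Hattempt : attempt D q).
  { intros z Hz. destruct (Hval z Hz) as [p Hp].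
    rewrite (apq z p Hz Hp), (Hp z (cl_self z)). f_equal. apply image_ext.
    intros y Hy. apply mem_pred in Hy. symmetry. apply apq.
    - exact (Dcl z y Hz Hy).
    - apply (attempt_mono _ (cl z)); [|exact Hp]. intros u Hu. apply (cl_sub y); auto.
      apply (cl_closed z z); auto. }
  assert (Hcl : forall z, z ∈ cl x -> z = x \/ z ∈ D).
  { intros z Hz.
    assert (K : z ∈ union D (single x)).
    { apply (cl_sub x); [|rewrite mem_union, mem_single; tauto|exact Hz].
      intros y u Hy Hu. apply mem_union. left. apply mem_union in Hy. destruct Hy as [Hy|Hy].
      - exact (Dcl y u Hy Hu).
      - apply mem_single in Hy. subst y. apply HD. eauto. }
    rewrite mem_union, mem_single in K. tauto. }
  (* If x is in D, the closure of x lies in D and q is already an attempt; otherwise the pair for x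
     can be added without changing q on D. *)
  destruct (classic (x ∈ D)) as [Hx|Hx].
  - exists q. apply (attempt_mono _ D); [|exact Hattempt].
    intros z Hz. destruct (Hcl z Hz) as [->|]; assumption.
  - set (val := G x (image (ap q) (pred x))).
    assert (E1 : forall z, z ∈ D -> ap (union q (single (pr x val))) z = ap q z).
    { intros z Hz. apply ext_eq. intros u. rewrite !mem_ap.
      split; intros (y & Hy & Hu); exists y; (split; [|exact Hu]).
      - rewrite mem_union, mem_single in Hy. destruct Hy as [Hy|Hy]; [exact Hy|].
        apply pr_inj in Hy. destruct Hy as [-> _]. contradiction.
      - rewrite mem_union. tauto. }
    assert (E2 : ap (union q (single (pr x val))) x = val).
    { apply ap_eq; [rewrite mem_union, mem_single; tauto|].
      intros y Hy. rewrite mem_union, mem_single in Hy. destruct Hy as [Hy|Hy].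
      - apply Hq in Hy. destruct Hy as (z & Hz & v & _ & E).
        apply pr_inj in E. destruct E as [-> _]. contradiction.
      - now apply pr_inj in Hy. }
    exists (union q (single (pr x val))).
    intros z Hz. destruct (classic (z ∈ D)) as [HzD|HzD].
    + rewrite (E1 z HzD), (Hattempt z HzD). f_equal. apply image_ext.
      intros y Hy. symmetry. apply E1. apply mem_pred in Hy. exact (Dcl z y HzD Hy).
    + destruct (Hcl z Hz) as [->|]; [|contradiction].
      rewrite E2. unfold val. f_equal. apply image_ext.
      intros y Hy. symmetry. apply E1. apply mem_pred in Hy. apply HD. eauto.
Qed.

Lemma recursion : exists F : V -> V, fun1 F /\
  forall x, F x = G x (image F (setof (fun y => R y x))).
Proof.
  assert (Hs : forall x, is_set (fun z => exists p, attempt (cl x) p /\ z ∈ ap p x)).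
  { intros x. destruct (attempt_exists x) as [p Hp].
    apply (is_set_sub (fun z => z ∈ ap p x)); [apply is_set_mem|dfn|].
    intros z (q & Hq & Hz). rewrite (attempt_unique (cl x) p q); auto. }
  (* Writing the value as the set of its members makes its definability an instance of [term_setof];
     all attempts give the same members. *)
  exists (fun x => setof (fun z => exists p, attempt (cl x) p /\ z ∈ ap p x)).
  assert (HF : forall x p, attempt (cl x) p ->
    setof (fun z => exists p, attempt (cl x) p /\ z ∈ ap p x) = ap p x).
  { intros x p Hp. apply ext_eq. intros z.
    rewrite (mem_setof _ (Hs x)). split; [|eauto].
    intros (q & Hq & Hz). rewrite (attempt_unique (cl x) p q); auto. }
  split.
  - intros X t Ht.
    apply (term_setof _ (fun i e z => exists p, attempt (cl (t i e)) p /\ z ∈ ap p (t i e))).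
    + intros i e. apply Hs.
    + repeat dfn_step.
  - intros x. destruct (attempt_exists x) as [p Hp].
    rewrite (HF x p Hp), (Hp x (cl_self x)). f_equal. apply image_ext.
    intros y Hy. symmetry. apply HF. apply mem_pred in Hy.
    apply (attempt_mono _ (cl x)); [|exact Hp]. intros u Hu. apply (cl_sub y); auto.
    apply (cl_closed x x); auto.
Qed.
End Recursion.

(** * Ordinals, stages and choice *)

Lemma def1_ordinal : def1 ordinal.
Proof. unfold ordinal, transitive. dfn. Qed.
#[local] Hint Resolve def1_ordinal : dfn.

Lemma mem_irrefl3 (x y z : V) : x ∈ y -> y ∈ z -> ~ z ∈ x.
Proof.
  intros H1 H2 H3.
  destruct (mem_minimal (fun u => u = x \/ u = y \/ u = z)) as (m & Hm & K); [dfn|eauto|].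
  destruct Hm as [-> | [-> | ->]]; [apply (K z)|apply (K x)|apply (K y)]; tauto.
Qed.

Lemma ordinal_mem (a b : V) : ordinal a -> b ∈ a -> ordinal b.
Proof.
  intros [T L] Hb. split.
  - intros c Hc d Hd. assert (Hca := T b Hb c Hc). assert (Hda := T c Hca d Hd).
    destruct (L d b Hda Hb) as [H|[->|H]]; [exact H| |].
    + destruct (mem_asym b c Hd Hc).
    + destruct (mem_irrefl3 d c b Hd Hc H).
  - intros x y Hx Hy. apply L; now apply (T b).
Qed.

(** The least element of b outside a, if there is one, has the same members as a. *)
Lemma ordinal_subset (a b : V) : transitive a -> ordinal b -> subset a b -> a = b \/ a ∈ b.
Proof.
  intros Ta [Tb Lb] S. destruct (classic (a = b)) as [|N]; [tauto|]. right.
  destruct (mem_minimal (fun m => m ∈ b /\ ~ m ∈ a)) as (m & [Hm Hma] & K); [dfn| |].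
  - apply NNPP. intros H. apply N, ext_eq. intros z. split; [apply S|].
    intros Hz. apply NNPP. intros Hz'. apply H. eauto.
  - replace a with m; [exact Hm|]. apply ext_eq. intros z. split.
    + intros Hz. apply NNPP. intros Hz'. apply (K z Hz). split; [exact (Tb m Hm z Hz)|exact Hz'].
    + intros Hz. destruct (Lb z m (S z Hz) Hm) as [H|[->|H]]; [exact H|contradiction|].
      destruct Hma. exact (Ta z Hz m H).
Qed.

Lemma ordinal_compare (a b : V) : ordinal a -> ordinal b -> a ∈ b \/ a = b \/ b ∈ a.
Proof.
  intros Ha Hb.
  (* The intersection c equals or belongs to each of a and b, and it cannot belong to both since c ∈
     c is impossible. *)
  destruct (is_set_sep a (fun z => z ∈ b)) as [c Hc]; [dfn|].
  assert (Tc : transitive c).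
  { intros x Hx y Hy. apply Hc in Hx. apply Hc.
    split; [exact (proj1 Ha x (proj1 Hx) y Hy)|exact (proj1 Hb x (proj2 Hx) y Hy)]. }
  destruct (ordinal_subset c a Tc Ha) as [E|H]; [intros z; rewrite Hc; tauto| |];
  destruct (ordinal_subset c b Tc Hb) as [E'|H']; try (intros z; rewrite Hc; tauto).
  - right. left. congruence.
  - left. now rewrite <- E.
  - right. right. now rewrite <- E'.
  - destruct (mem_irrefl c). now apply Hc.
Qed.

Lemma ordinal_succ (a : V) : ordinal a -> ordinal (succ a).
Proof.
  intros [T L]. split.
  - intros x Hx y Hy. rewrite mem_succ in *. destruct Hx as [Hx| ->]; [|tauto].
    left. exact (T x Hx y Hy).
  - intros x y Hx Hy. rewrite mem_succ in *. destruct Hx as [Hx| ->], Hy as [Hy| ->]; auto.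
Qed.

Lemma ordinal_bigU (s : V) : (forall a, a ∈ s -> ordinal a) -> ordinal (bigU s).
Proof.
  intros H. split.
  - intros x Hx y Hy. apply mem_bigU in Hx. destruct Hx as (a & Ha & Hx).
    apply mem_bigU. exists a. split; [exact Ha|]. exact (proj1 (H a Ha) x Hx y Hy).
  - intros x y Hx Hy. apply mem_bigU in Hx, Hy.
    destruct Hx as (a & Ha & Hx), Hy as (b & Hb & Hy).
    apply ordinal_compare; [apply (ordinal_mem a)|apply (ordinal_mem b)]; auto.
Qed.

Lemma def2_mem : def2 (fun y x => y ∈ x).
Proof. dfn. Qed.

Lemma stage_exists : exists F : V -> V, fun1 F /\
  forall x z, z ∈ F x <-> exists y, y ∈ x /\ subset z (F y).
Proof.
  destruct (recursion (fun y x => y ∈ x) def2_mem is_set_mem mem_induction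
              (fun x s => bigU (image pow s))) as (F & HF & E); [dfn|].
  exists F. split; [exact HF|]. intros x z. rewrite E, mem_bigU.
  rewrite <- (proj2 (eq_setof (fun y => y ∈ x) x (is_set_mem x)) (fun y => iff_refl _)).
  split.
  - intros (p & Hp & Hz). apply mem_image in Hp; [|dfn]. destruct Hp as (w & Hw & ->).
    apply mem_image in Hw; [|exact HF]. destruct Hw as (y & Hy & ->).
    exists y. split; [exact Hy|now apply mem_pow].
  - intros (y & Hy & Hz). exists (pow (F y)). split; [|now apply mem_pow].
    apply mem_image; [dfn|]. exists (F y). split; [|reflexivity].
    apply mem_image; [exact HF|]. now exists y.
Qed.

(** [stage a] is V_a for an ordinal [a]; for an arbitrary set it is V_r, with [r] its
    rank. *)
Definition stage : V -> V := proj1_sig (constructive_indefinite_description _ stage_exists).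
Lemma fun1_stage : fun1 stage.
Proof. unfold stage. now destruct constructive_indefinite_description as (F & H & E). Qed.
#[local] Hint Resolve fun1_stage : dfn.
Lemma mem_stage (x z : V) : z ∈ stage x <-> exists y, y ∈ x /\ subset z (stage y).
Proof. unfold stage. now destruct constructive_indefinite_description as (F & H & E). Qed.

Lemma stage_mono (x y : V) : subset x y -> subset (stage x) (stage y).
Proof.
  intros H z Hz. rewrite mem_stage in *. destruct Hz as (w & Hw & Hz). eauto.
Qed.

Lemma in_stage (x : V) : exists a, ordinal a /\ x ∈ stage a.
Proof.
  revert x. apply mem_induction; [dfn|]. intros x IH.
  (* Replacement needs one index per member of x, hence the least one. Their supremum bounds all
     members, and x itself appears one stage later. *)
  set (least := fun y a => ordinal a /\ y ∈ stage a /\ forall b, b ∈ a -> ~ y ∈ stage b).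
  assert (Dleast : def2 least) by (unfold least; dfn).
  destruct (is_set_replace x least) as [s Hs].
  - exact Dleast.
  - intros y a b _ (Oa & Ya & La) (Ob & Yb & Lb).
    destruct (ordinal_compare a b Oa Ob) as [H|[H|H]]; [|exact H|].
    + destruct (Lb a H Ya).
    + destruct (La b H Yb).
  - assert (Os : ordinal (bigU s)).
    { apply ordinal_bigU. intros a Ha. apply Hs in Ha. now destruct Ha as (y & _ & Ha & _). }
    exists (succ (bigU s)). split; [now apply ordinal_succ|].
    apply mem_stage. exists (bigU s). split; [apply mem_succ; tauto|].
    intros y Hy.
    destruct (mem_minimal (fun a => ordinal a /\ y ∈ stage a)) as (a & [Oa Ya] & K);
      [dfn|exact (IH y Hy)|].
    apply (stage_mono a); [|exact Ya].
    intros z Hz. apply mem_bigU. exists a. split; [|exact Hz].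
    apply Hs. exists y. split; [exact Hy|]. split; [exact Oa|]. split; [exact Ya|].
    intros b Hb Hb'. apply (K b Hb). split; [|exact Hb']. exact (ordinal_mem a b Oa Hb).
Qed.

Lemma set_choice : exists c : V -> V, fun1 c /\ forall x, (exists z, z ∈ x) -> c x ∈ x.
Proof.
  destruct (gbc_global_choice V hV) as (F & HF & Ffun & Fc).
  apply def1_class in HF.
  assert (Hs : forall x, is_set (fun t => exists y, F (pr x y) /\ t ∈ y)).
  { intros x. destruct (classic (exists y, F (pr x y))) as [[y Hy]|N].
    - apply (is_set_sub (fun t => t ∈ y)); [apply is_set_mem|dfn|].
      intros t (y' & Hy' & Ht). rewrite <- class_app_pr in *.
      now rewrite (Ffun x y y').
    - apply (is_set_sub (fun t => t ∈ x)); [apply is_set_mem|dfn|].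
      intros t (y' & Hy' & _). destruct N. eauto. }
  (* Taking the members of the value makes the partial class function total, with the empty set as
     default. *)
  exists (fun x => setof (fun t => exists y, F (pr x y) /\ t ∈ y)). split.
  - intros X t Ht. apply (term_setof _ (fun i e u => exists y, F (pr (t i e) y) /\ u ∈ y)).
    + intros i e. apply Hs.
    + repeat dfn_step.
  - intros x Hx. destruct (Fc x Hx) as (y & Hy & Fy).
    replace (setof _) with y; [exact Hy|]. apply eq_setof; [apply Hs|].
    intros t. rewrite class_app_pr in Fy. split; [eauto|].
    intros (y' & Hy' & Ht). rewrite <- class_app_pr in *. now rewrite (Ffun x y y').
Qed.

(** The candidates of least rank form a set, to which global choice applies. *)
Lemma class_choice (R : V -> V -> Prop) : def2 R ->
  exists s : V -> V, fun1 s /\ forall x y, R x y -> R x (s x).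
Proof.
  intros HR. destruct set_choice as (c & Hc & Hc').
  set (T := fun x y => R x y /\ exists a, ordinal a /\ y ∈ stage a /\
                        forall b y', b ∈ a -> y' ∈ stage b -> ~ R x y').
  assert (HT : forall x, is_set (T x)).
  { intros x. destruct (classic (exists y, T x y)) as [(y & Hy & a & Oa & Ya & La)|N].
    - apply (is_set_sub (fun y => y ∈ stage a)); [apply is_set_mem|unfold T; dfn|].
      intros y' (Hy' & b & Ob & Yb & Lb).
      destruct (ordinal_compare a b Oa Ob) as [H|[->|H]]; [|exact Yb|].
      + destruct (Lb a y H Ya Hy).
      + destruct (La b y' H Yb Hy').
    - apply (is_set_sub (fun t => t ∈ x)); [apply is_set_mem|unfold T; dfn|].
      intros y' Hy'. destruct N. eauto. }
  exists (fun x => c (setof (T x))). split.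
  - intros X t Ht. apply Hc, (term_setof _ (fun i e => T (t i e))); [intros; apply HT|].
    unfold T. repeat dfn_step.
  - intros x y Hxy.
    enough (K : c (setof (T x)) ∈ setof (T x)) by (apply (mem_setof _ (HT x)) in K; apply K).
    apply Hc'.
    destruct (mem_minimal (fun a => ordinal a /\ exists y', y' ∈ stage a /\ R x y'))
      as (a & (Oa & y' & Ya & Hy') & K); [dfn| |].
    + destruct (in_stage y) as (a & Oa & Ya). eauto.
    + exists y'. apply (mem_setof _ (HT x)). split; [exact Hy'|].
      exists a. split; [exact Oa|]. split; [exact Ya|].
      intros b u Hb Hu Ru. apply (K b Hb). split; [exact (ordinal_mem a b Oa Hb)|eauto].
Qed.

(** * ZFC in the sets of V *)

Lemma def_holds (Y X : Set) (phi : set_formula X) (t : unit -> X -> (Y -> V) -> V) :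
  (forall x, term frm (fun i => t i x)) ->
  definable frm (fun i e => holds V phi (fun x => t i x e)).
Proof.
  apply (def_sat frm Empty_set (fun _ c => match c with end) X phi). intros [].
Qed.

Lemma separation_V : Separation V.
Proof.
  intros X phi e a. apply is_set_sep. intros Y t Ht.
  apply (def_holds Y _ phi (fun i o e' => match o with Some x => e x | None => t i e' end)).
  intros [x|]; [apply term_const|exact Ht].
Qed.

Lemma replacement_V : Replacement V.
Proof.
  intros X phi e a R. apply (is_set_replace a R). intros Y t s Ht Hs.
  apply (def_holds Y _ phi (fun i o e' => match o with
    | Some (Some x) => e x | Some None => t i e' | None => s i e' end)).
  intros [[x|]|]; [apply term_const|exact Ht|exact Hs].
Qed.

Lemma foundation_V : Foundation V.
Proof. intros a. apply mem_minimal. dfn. Qed.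

Lemma choice_V : Choice V.
Proof.
  destruct set_choice as (c & Hc & Hc').
  intros a Hne Hdisj. exists (image c a). intros x Hx.
  exists (c x). split.
  - split; [now apply Hc', Hne|]. apply mem_image; eauto.
  - intros z [Hz Hz']. apply mem_image in Hz'; [|exact Hc].
    destruct Hz' as (y & Hy & ->).
    now rewrite (Hdisj x y (c y) Hx Hy Hz (Hc' y (Hne y Hy))).
Qed.

Lemma zfc_V : ZFC V.
Proof.
  split; try apply hV.
  - exact foundation_V.
  - exact separation_V.
  - exact replacement_V.
  - exact choice_V.
Qed.

Lemma subset_stage (x : V) : subset x (stage x).
Proof.
  revert x. apply (mem_induction (fun x => subset x (stage x))); [dfn|].
  intros x IH y Hy. apply mem_stage. exists y. split; [exact Hy|now apply IH].
Qed.

(** * Measures *)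

Section Measure.
Context {k U : V} (HU : measure k U).

Let Ok : ordinal k := proj1 HU.
Let Hult : ultrafilter_on U k := proj1 (proj2 HU).

(** The quantifier for almost all t. Asking only that P hold throughout some member of U gives it a
    meaning even where P is not definable. *)
Definition ae (P : V -> Prop) : Prop := exists u, u ∈ U /\ forall t, t ∈ u -> P t.

Lemma ae_everywhere (P : V -> Prop) : (forall t, t ∈ k -> P t) -> ae P.
Proof. intros H. exists k. split; [apply Hult|exact H]. Qed.

Lemma ae_and (P Q : V -> Prop) : ae P -> ae Q -> ae (fun t => P t /\ Q t).
Proof.
  intros (u & Hu & Pu) (v & Hv & Qv).
  destruct (is_set_sep u (fun t => t ∈ v)) as [w Hw]; [dfn|].
  exists w. split.
  - exact (uf_inter U k Hult u v w Hu Hv Hw).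
  - intros t Ht. apply Hw in Ht. split; [now apply Pu|now apply Qv].
Qed.

Lemma ae_mono (P Q : V -> Prop) : ae P -> (forall t, t ∈ k -> P t -> Q t) -> ae Q.
Proof.
  intros (u & Hu & Pu) H. exists u. split; [exact Hu|].
  intros t Ht. apply H; [exact (uf_subset U k Hult u Hu t Ht)|now apply Pu].
Qed.

Lemma ae_mono2 (P Q S : V -> Prop) :
  ae P -> ae Q -> (forall t, t ∈ k -> P t -> Q t -> S t) -> ae S.
Proof.
  intros HP HQ H. apply (ae_mono _ _ (ae_and _ _ HP HQ)). intros t Ht [H1 H2]. now apply H.
Qed.

Lemma ae_point (P : V -> Prop) : ae P -> exists t, t ∈ k /\ P t.
Proof.
  intros (u & Hu & Pu). destruct (uf_nonempty U k Hult u Hu) as [t Ht].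
  exists t. split; [exact (uf_subset U k Hult u Hu t Ht)|now apply Pu].
Qed.

Lemma ae_set (P : V -> Prop) (s : V) :
  ae P -> (forall t, t ∈ s <-> t ∈ k /\ P t) -> s ∈ U.
Proof.
  intros (u & Hu & Pu) Hs. apply (uf_upward U k Hult u s Hu).
  - intros t Ht. apply Hs. split; [exact (uf_subset U k Hult u Hu t Ht)|now apply Pu].
  - intros t Ht. now apply Hs in Ht.
Qed.

Lemma ae_or_not (P : V -> Prop) : def1 P -> ae P \/ ae (fun t => ~ P t).
Proof.
  intros HP.
  destruct (is_set_sep k P HP) as [x Hx].
  destruct (is_set_sep k (fun t => ~ t ∈ x)) as [y Hy]; [dfn|].
  destruct (uf_ultra U k Hult x y) as [H|H].
  - intros t Ht. now apply Hx in Ht.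
  - exact Hy.
  - left. exists x. split; [exact H|]. intros t Ht. now apply Hx in Ht.
  - right. exists y. split; [exact H|]. intros t Ht Pt. apply Hy in Ht.
    destruct Ht as [Ht Hn]. apply Hn, Hx. tauto.
Qed.

Lemma ae_not (P : V -> Prop) : def1 P -> (~ ae P <-> ae (fun t => ~ P t)).
Proof.
  intros HP. split.
  - destruct (ae_or_not P HP); tauto.
  - intros H K. destruct (ae_point _ (ae_and _ _ H K)) as (t & _ & H1 & H2). tauto.
Qed.

(** If almost all t were equal to a, every member of U would contain a and U would be principal. *)
Lemma ae_neq (a : V) : ae (fun t => t <> a).
Proof.
  apply ae_not; [dfn|]. intros (u & Hu & H).
  assert (Ha : a ∈ u).
  { destruct (uf_nonempty U k Hult u Hu) as [t Ht]. now rewrite <- (H t Ht). }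
  apply (proj1 (proj2 (proj2 HU))). exists a.
  split; [exact (uf_subset U k Hult u Hu a Ha)|].
  intros x. split.
  - intros Hx. split; [exact (uf_subset U k Hult x Hx)|].
    destruct (ae_point (fun t => t ∈ u /\ t ∈ x)) as (t & _ & Ht & Hx').
    + apply ae_and; [now exists u|now exists x].
    + now rewrite <- (H t Ht).
  - intros [Hs Hx]. apply (uf_upward U k Hult u x Hu); [|exact Hs].
    intros t Ht. now rewrite (H t Ht).
Qed.

(** [complete] concerns a set of members of U equipotent to an ordinal below k; injectivity of Y
    supplies the bijection from [image Y d] to d. *)
Lemma ae_forall_injective (d : V) (Y : V -> V) : d ∈ k -> fun1 Y ->
  (forall a, a ∈ d -> Y a ∈ U) ->
  (forall a b, a ∈ d -> b ∈ d -> Y a = Y b -> a = b) ->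
  ae (fun t => forall a, a ∈ d -> t ∈ Y a).
Proof.
  intros Hd HY HYU inj.
  destruct (is_set_sep k (fun t => forall x, x ∈ image Y d -> t ∈ x)) as [z Hz]; [dfn|].
  exists z. split.
  - apply (proj2 (proj2 (proj2 HU)) (image Y d)); [| |exact Hz].
    + intros x Hx. apply mem_image in Hx; [|exact HY]. destruct Hx as (a & Ha & ->). auto.
    + exists d. split; [exact Hd|]. exists (image (fun a => pr (Y a) a) d).
      assert (Happ : forall x a, app (image (fun a => pr (Y a) a) d) x a <-> a ∈ d /\ x = Y a).
      { intros x a. rewrite app_pr, mem_image by dfn. split.
        - intros (b & Hb & E). apply pr_inj in E. now destruct E as [-> ->].
        - intros [Ha ->]. eauto. }
      split; [split|split].
      * intros p Hp. apply mem_image in Hp; [|dfn]. destruct Hp as (a & Ha & ->).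
        exists (Y a), a. split; [apply mem_image; eauto|now apply is_pair_pr].
      * intros x Hx. apply mem_image in Hx; [|exact HY]. destruct Hx as (a & Ha & ->).
        exists a. split; [now apply Happ|].
        intros b Hb. apply Happ in Hb. now apply inj.
      * intros x a H. now apply Happ in H.
      * intros a Ha. exists (Y a). split; [now apply Happ|].
        intros x Hx. now apply Happ in Hx.
  - intros t Ht a Ha. apply Hz in Ht. apply Ht, mem_image; eauto.
Qed.

(** Completeness for arbitrary families indexed by [d < k].  The sets are made
    distinct by removing [d] from each of them and adding back its index, so that the
    family is equipotent to [d] itself. *)
Lemma ae_forall (d : V) (P : V -> V -> Prop) : d ∈ k -> def2 P ->
  (forall a, a ∈ d -> ae (P a)) -> ae (fun t => forall a, a ∈ d -> P a t).
Proof.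
  intros Hd HP H.
  assert (Hdk : subset d k) by exact (proj1 Ok d Hd).
  (* The complements in k of the singletons of points of d are already distinct, so the injective
     case applies to them. *)
  assert (Hbd : ae (fun t => ~ t ∈ d)).
  { assert (Hs : forall a, is_set (fun t => t ∈ k /\ t <> a))
      by (intros a; apply is_set_sep; dfn).
    assert (K : ae (fun t => forall a, a ∈ d -> t ∈ setof (fun t => t ∈ k /\ t <> a))).
    { apply ae_forall_injective; [exact Hd| | |].
      - intros X t Ht. apply (term_setof _ (fun i e u => u ∈ k /\ u <> t i e));
          [intros; apply Hs|repeat dfn_step].
      - intros a _. apply (ae_set (fun t => t <> a)); [apply ae_neq|].
        exact (mem_setof _ (Hs a)).
      - intros a b Ha Hb E. apply NNPP. intros N.
        assert (K : b ∈ setof (fun t => t ∈ k /\ t <> a)).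
        { apply (mem_setof _ (Hs a)). auto. }
        rewrite E in K. apply (mem_setof _ (Hs b)) in K. tauto. }
    apply (ae_mono _ _ K). intros t _ Kt Ht. specialize (Kt t Ht).
    apply (mem_setof _ (Hs t)) in Kt. tauto. }
  set (Q := fun a t => t = a \/ t ∈ k /\ P a t /\ ~ t ∈ d).
  assert (Hs : forall a, is_set (Q a)).
  { intros a. apply (is_set_sub (fun t => t ∈ union k (single a)));
      [apply is_set_mem|unfold Q; dfn|].
    intros t Ht. rewrite mem_union, mem_single. unfold Q in Ht. tauto. }
  assert (K : ae (fun t => forall a, a ∈ d -> t ∈ setof (Q a))).
  { apply ae_forall_injective; [exact Hd| | |].
    - intros X t Ht. apply (term_setof _ (fun i e => Q (t i e)));
        [intros; apply Hs|unfold Q; repeat dfn_step].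
    - intros a Ha. apply (ae_set (fun t => t = a \/ P a t /\ ~ t ∈ d)).
      + apply (ae_mono2 _ _ _ (H a Ha) Hbd). tauto.
      + intros t. rewrite (mem_setof _ (Hs a)). unfold Q. split; [|tauto].
        intros [->|]; [|tauto]. auto.
    - intros a b Ha Hb E.
      assert (K : a ∈ setof (Q a)) by (apply (mem_setof _ (Hs a)); now left).
      rewrite E in K. apply (mem_setof _ (Hs b)) in K. destruct K; tauto. }
  apply (ae_mono2 _ _ _ K Hbd). intros t _ Kt Ht a Ha. specialize (Kt a Ha).
  apply (mem_setof _ (Hs a)) in Kt. destruct Kt as [->|]; tauto.
Qed.

(** * Small sets *)

Definition small (A : V) : Prop := forall h : V,
  ae (fun t => ap h t ∈ A) -> exists a, a ∈ A /\ ae (fun t => ap h t = a).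

Lemma def1_small : def1 small.
Proof. unfold small, ae. dfn. Qed.

(** A choice function for R, restricted to k, is a set and so is constant almost everywhere. This
    moves the existential quantifier in front of the almost-all quantifier. *)
Lemma small_choice (A : V) (R : V -> V -> Prop) : small A -> def2 R ->
  ae (fun t => exists a, a ∈ A /\ R t a) -> exists a, a ∈ A /\ ae (fun t => R t a).
Proof.
  intros HA HR H.
  destruct (class_choice (fun t a => a ∈ A /\ R t a)) as (s & Hs & Hc); [dfn|].
  assert (K : ae (fun t => ap (lam k s) t ∈ A /\ R t (ap (lam k s) t))).
  { apply (ae_mono _ _ H). intros t Ht (a & Ha). rewrite ap_lam by assumption. eauto. }
  destruct (HA (lam k s)) as (a & Ha & E).
  - apply (ae_mono _ _ K). tauto.
  - exists a. split; [exact Ha|]. apply (ae_mono2 _ _ _ K E). intros t _ [_ Ht] Et.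
    now rewrite Et in Ht.
Qed.

Lemma small_subset (A B : V) : small A -> subset B A -> small B.
Proof.
  intros HA HB h Hh. destruct (HA h) as (a & Ha & E).
  - apply (ae_mono _ _ Hh). auto.
  - exists a. split; [|exact E].
    destruct (ae_point _ (ae_and _ _ Hh E)) as (t & _ & Ht & <-). exact Ht.
Qed.

(** The constant value must be the set y of those x in A that lie in h(t) for almost all t. If h(t)
    differed from y almost everywhere, smallness of A would give one x witnessing the difference for
    almost all t, against the choice of y. *)
Lemma small_pow (A : V) : small A -> small (pow A).
Proof.
  intros HA h Hh.
  destruct (is_set_sep A (fun x => ae (fun t => x ∈ ap h t))) as [y Hy]; [unfold ae; dfn|].
  exists y. split; [apply mem_pow; intros x Hx; now apply Hy in Hx|].
  apply NNPP. intros N. apply ae_not in N; [|dfn].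
  destruct (small_choice A (fun t x => ~ (x ∈ ap h t <-> x ∈ y))) as (x & Hx & K).
  - exact HA.
  - dfn.
  - apply (ae_mono2 _ _ _ Hh N). intros t _ Ht Nt. apply mem_pow in Ht.
    apply NNPP. intros F. apply Nt, ext_eq. intros z.
    destruct (classic (z ∈ A)) as [Hz|Hz].
    + apply NNPP. intros F'. apply F. eauto.
    + split; intros Hz'; destruct Hz; [now apply Ht|now apply Hy in Hz'].
  - destruct (ae_or_not (fun t => x ∈ ap h t)) as [H|H]; [dfn| |].
    + destruct (ae_point _ (ae_and _ _ H K)) as (t & _ & H1 & H2).
      apply H2. rewrite Hy. tauto.
    + destruct (ae_point _ (ae_and _ _ H K)) as (t & _ & H1 & H2).
      apply H2. split; [tauto|]. intros H3. apply Hy in H3. destruct H3 as [_ H3].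
      apply ae_not in H; [|dfn]. tauto.
Qed.

Lemma small_prod (A B : V) : small A -> small B -> small (prod A B).
Proof.
  intros HA HB h Hh.
  destruct (small_choice A (fun t x => exists y, y ∈ B /\ ap h t = pr x y)) as (x & Hx & Kx);
    [exact HA|dfn| |].
  { apply (ae_mono _ _ Hh). intros t _ Ht. apply mem_prod in Ht.
    destruct Ht as (x & y & ? & ? & ?). eauto. }
  destruct (small_choice B (fun t y => ap h t = pr x y)) as (y & Hy & Ky);
    [exact HB|dfn|exact Kx|].
  exists (pr x y). split; [|exact Ky]. apply mem_prod. eauto.
Qed.

Lemma small_below (d : V) : d ∈ k -> small d.
Proof.
  intros Hd h Hh. apply NNPP. intros N.
  assert (K : ae (fun t => forall a, a ∈ d -> ap h t <> a)).
  { apply (ae_forall d (fun a t => ap h t <> a) Hd); [dfn|].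
    intros a Ha. apply ae_not; [dfn|]. eauto. }
  destruct (ae_point _ (ae_and _ _ Hh K)) as (t & _ & H1 & H2). exact (H2 _ H1 eq_refl).
Qed.

(** The map would be constant on a member of U, which has two distinct points because U is
    nonprincipal. *)
Lemma small_injection (A : V) (g : V -> V) : small A -> fun1 g ->
  (forall t, t ∈ k -> g t ∈ A) ->
  ~ (forall s t, s ∈ k -> t ∈ k -> g s = g t -> s = t).
Proof.
  intros HA Hg HgA inj.
  destruct (small_choice A (fun t a => g t = a)) as (a & _ & E); [exact HA|dfn| |].
  - apply ae_everywhere. eauto.
  - destruct (ae_point _ E) as (s & Hs & Es).
    destruct (ae_point _ (ae_and _ _ E (ae_neq s))) as (t & Ht & H1 & H2).
    apply H2, inj; congruence.
Qed.

Lemma small_stage (b : V) : b ∈ k -> small (stage b).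
Proof.
  assert (D := def1_small). revert b.
  apply (mem_induction (fun b => b ∈ k -> small (stage b))); [dfn|].
  intros b IH Hb h Hh.
  (* Smallness of b fixes one index c for almost all t, which reduces the claim to the power set of
     [stage c]. *)
  destruct (small_choice b (fun t c => subset (ap h t) (stage c))) as (c & Hc & E);
    [now apply small_below|dfn| |].
  - apply (ae_mono _ _ Hh). intros t _ Ht. now apply mem_stage in Ht.
  - destruct (small_pow (stage c)) with (h := h) as (a & Ha & Ea).
    + apply IH; [exact Hc|]. exact (proj1 Ok b Hb c Hc).
    + apply (ae_mono _ _ E). intros t _ Ht. now apply mem_pow.
    + exists a. split; [|exact Ea]. apply mem_stage. exists c. split; [exact Hc|].
      now apply mem_pow.
Qed.

(** To be applied to the measure j(U) on j(k), with the original k as A. *)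
Lemma no_injection_pow_prod (d A : V) (g : V -> V) : d ∈ k -> subset A d -> fun1 g ->
  (forall t, t ∈ k -> g t ∈ pow (prod A A)) ->
  ~ (forall s t, s ∈ k -> t ∈ k -> g s = g t -> s = t).
Proof.
  intros Hd HA. assert (K : small A) by (apply (small_subset d); [now apply small_below|exact HA]).
  apply small_injection. now apply small_pow, small_prod.
Qed.
End Measure.

Arguments ae U P : clear implicits.
Arguments small U A : clear implicits.

(** * The collapsed ultrapower *)

Section Ultrapower.
(** The set w indexes descending sequences and is later instantiated with omega; w ∈ k is what makes
    completeness countable completeness. *)
Context (k U : V) (HU : measure k U) (w : V) (wk : w ∈ k) (w_inhabited : exists n, n ∈ w)
  (w_succ : forall n, n ∈ w -> succ n ∈ w).

Definition mem_ae (g f : V) : Prop := ae U (fun t => ap g t ∈ ap f t).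
Definition eq_ae (g f : V) : Prop := ae U (fun t => ap g t = ap f t).

(** [mem_ae] has a proper class of predecessors; up to [eq_ae], those in the following
    set suffice. *)
Definition pred_ae (g f : V) : Prop :=
  g ∈ pow (prod k (bigU (bigU (bigU f)))) /\ mem_ae g f.

Lemma def2_mem_ae : def2 mem_ae.
Proof. unfold mem_ae, ae. dfn. Qed.
Lemma def2_eq_ae : def2 eq_ae.
Proof. unfold eq_ae, ae. dfn. Qed.
#[local] Hint Resolve def2_mem_ae def2_eq_ae : dfn.
Lemma def2_pred_ae : def2 pred_ae.
Proof. unfold pred_ae. dfn. Qed.
#[local] Hint Resolve def2_pred_ae : dfn.

Lemma is_set_pred_ae (f : V) : is_set (fun g => pred_ae g f).
Proof. unfold pred_ae. apply is_set_sep. dfn. Qed.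

(** The graph of g is cut down to the bounding product. Wherever g(t) ∈ f(t) the pair survives, and
    that is almost everywhere. *)
Lemma pred_ae_normalize (g f : V) : mem_ae g f -> exists h, pred_ae h f /\ eq_ae h g.
Proof.
  intros H.
  destruct (is_set_sep (prod k (bigU (bigU (bigU f)))) (fun p => exists x, p = pr x (ap g x)))
    as [h Hh]; [dfn|].
  assert (E : eq_ae h g).
  { apply (ae_mono HU _ _ H). intros t Ht Hm. apply ap_eq.
    - apply Hh. split; [|eauto]. apply mem_prod. exists t, (ap g t).
      split; [exact Ht|]. split; [|reflexivity]. exact (mem_ap_bigU f t _ Hm).
    - intros y Hy. apply Hh in Hy. destruct Hy as [_ (x & E)].
      apply pr_inj in E. now destruct E as [<- ->]. }
  exists h. split; [|exact E]. split.
  - apply mem_pow. intros p Hp. now apply Hh in Hp.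
  - apply (ae_mono2 HU _ _ _ H E). intros t _ H1 H2. now rewrite H2.
Qed.

(** A descending sequence would, by countable completeness, be descending at some
    point of [k]. *)
Lemma pred_ae_well_founded : well_founded_class pred_ae.
Proof.
  intros P HP Hprog f0. apply NNPP. intros Hf0.
  (* The recursion below passes to s the set of values at the predecessors of n: {h(m)} if n is the
     successor of m, where s must pick a predecessor of h(m) outside P, and the empty set otherwise,
     where f0 shows that a choice exists. *)
  destruct (class_choice (fun z g => ~ P g /\ forall f, z = single f -> pred_ae g f))
    as (s & Hs & Hc); [dfn|].
  destruct (recursion (fun n m => m = succ n)) with (G := fun x z : V => s z)
    as (h & Hh & Eh).
  - dfn.
  - intros x. apply (is_set_sub (fun y => y ∈ x)); [apply is_set_mem|dfn|].
    intros y ->. apply mem_succ. tauto.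
  - intros Q HQ IH. apply mem_induction; [exact HQ|].
    intros x Hx. apply IH. intros y ->. apply Hx, mem_succ. tauto.
  - dfn.
  - assert (Hset : forall x, is_set (fun y => x = succ y)).
    { intros x. apply (is_set_sub (fun y => y ∈ x)); [apply is_set_mem|dfn|].
      intros y ->. apply mem_succ. tauto. }
    assert (Esucc : forall n, h (succ n) = s (single (h n))).
    { intros n. rewrite Eh. f_equal. apply ext_eq. intros z.
      rewrite mem_image, mem_single by assumption. split.
      - intros (y & Hy & ->). apply (mem_setof _ (Hset (succ n))) in Hy.
        now rewrite (succ_inj n y).
      - intros ->. exists n. split; [|reflexivity]. now apply (mem_setof _ (Hset (succ n))). }
    assert (Hstep : forall f, ~ P f -> ~ P (s (single f)) /\ pred_ae (s (single f)) f).
    { intros f Hf.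
      assert (K : exists g, pred_ae g f /\ ~ P g).
      { apply NNPP. intros N. apply Hf, Hprog. intros y Hy. apply NNPP. eauto. }
      destruct K as (g & Hg & HPg).
      destruct (Hc (single f) g) as [H1 H2].
      - split; [exact HPg|]. intros f' E.
        replace f' with f; [exact Hg|].
        assert (K : f ∈ single f') by (rewrite <- E; now apply mem_single).
        now apply mem_single in K.
      - split; [exact H1|]. now apply H2. }
    assert (HnP : forall n, ~ P (h n)).
    { apply mem_induction; [dfn|]. intros n IH.
      destruct (classic (exists m, n = succ m)) as [[m ->]|N].
      - rewrite Esucc. apply Hstep, IH, mem_succ. tauto.
      - rewrite Eh. apply (Hc _ f0). split; [exact Hf0|].
        intros f E. assert (K : f ∈ single f) by now apply mem_single.
        rewrite <- E in K. apply mem_image in K; [|exact Hh].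
        destruct K as (m & Hm & _). apply (mem_setof _ (Hset n)) in Hm. destruct N. eauto. }
    assert (A : ae U (fun t => forall n, n ∈ w -> ap (h (succ n)) t ∈ ap (h n) t)).
    { apply (ae_forall HU w (fun n t => ap (h (succ n)) t ∈ ap (h n) t) wk); [dfn|].
      intros n _. rewrite Esucc. apply Hstep, HnP. }
    destruct (ae_point HU _ A) as (t & _ & Ht).
    destruct (mem_minimal (fun u => exists n, n ∈ w /\ u = ap (h n) t))
      as (u & (n & Hn & ->) & K); [dfn| |].
    + destruct w_inhabited as [n Hn]. eauto.
    + apply (K (ap (h (succ n)) t)); [now apply Ht|]. eauto.
Qed.

(** * The transitive collapse *)

Lemma collapse_exists : exists F : V -> V, fun1 F /\
  forall f z, z ∈ F f <-> exists g, pred_ae g f /\ z = F g.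
Proof.
  destruct (recursion pred_ae def2_pred_ae is_set_pred_ae pred_ae_well_founded
              (fun x s => s)) as (F & HF & E); [dfn|].
  exists F. split; [exact HF|]. intros f z. rewrite E, mem_image by exact HF.
  split; intros (g & Hg & Hz); exists g; (split; [|exact Hz]);
    now apply (mem_setof _ (is_set_pred_ae f)).
Qed.

Definition pi : V -> V := proj1_sig (constructive_indefinite_description _ collapse_exists).
Lemma fun1_pi : fun1 pi.
Proof. unfold pi. now destruct constructive_indefinite_description as (F & H & E). Qed.
#[local] Hint Resolve fun1_pi : dfn.
Lemma mem_pi (f z : V) : z ∈ pi f <-> exists g, pred_ae g f /\ z = pi g.
Proof. unfold pi. now destruct constructive_indefinite_description as (F & H & E). Qed.

Lemma eq_ae_sym (f g : V) : eq_ae f g -> eq_ae g f.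
Proof. intros H. apply (ae_mono HU _ _ H). auto. Qed.
Lemma eq_ae_trans (f g h : V) : eq_ae f g -> eq_ae g h -> eq_ae f h.
Proof. intros H K. apply (ae_mono2 HU _ _ _ H K). congruence. Qed.
Lemma mem_ae_congr (f g f' g' : V) : eq_ae f f' -> eq_ae g g' -> mem_ae f g -> mem_ae f' g'.
Proof.
  intros Hf Hg H. apply (ae_mono2 HU _ _ _ H (ae_and HU _ _ Hf Hg)).
  intros t _ K [<- <-]. exact K.
Qed.
Lemma eq_ae_refl (f : V) : eq_ae f f.
Proof. now apply (ae_everywhere HU). Qed.

(** [pred_ae] is not invariant under [eq_ae], since its bound depends on f; predecessors of f are
    normalized anew for g, and the induction hypothesis absorbs the change. *)
Lemma pi_eq_of_eq_ae (f g : V) : eq_ae f g -> pi f = pi g.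
Proof.
  revert f g. apply (pred_ae_well_founded (fun f => forall g, eq_ae f g -> pi f = pi g)); [dfn|].
  intros f IH g E. apply ext_eq. intros z. rewrite !mem_pi. split.
  - intros (h & Hh & ->).
    destruct (pred_ae_normalize h g) as (h' & Hh' & E').
    + exact (mem_ae_congr h f h g (eq_ae_refl h) E (proj2 Hh)).
    + exists h'. split; [exact Hh'|]. apply IH; [exact Hh|]. now apply eq_ae_sym.
  - intros (h & Hh & ->).
    destruct (pred_ae_normalize h f) as (h' & Hh' & E').
    + exact (mem_ae_congr h g h f (eq_ae_refl h) (eq_ae_sym _ _ E) (proj2 Hh)).
    + exists h'. split; [exact Hh'|]. symmetry. now apply IH.
Qed.

(** If f and g differ almost everywhere, choose h(t) in their symmetric difference. Almost
    everywhere h is a member of the same one of the two, and by induction the equality of the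
    collapses makes it a member of the other. *)
Lemma eq_ae_of_pi_eq (f g : V) : pi f = pi g -> eq_ae f g.
Proof.
  revert f g. apply (pred_ae_well_founded (fun f => forall g, pi f = pi g -> eq_ae f g)); [dfn|].
  intros f IH g E. apply NNPP. intros N. apply (ae_not HU) in N; [|dfn].
  destruct (class_choice (fun t x => ~ (x ∈ ap f t <-> x ∈ ap g t))) as (s & Hs & Hc); [dfn|].
  set (h := lam k s).
  assert (H : ae U (fun t => ~ (ap h t ∈ ap f t <-> ap h t ∈ ap g t))).
  { apply (ae_mono HU _ _ N). intros t Ht Nt. unfold h. rewrite ap_lam by assumption.
    apply NNPP. intros K. apply Nt, ext_eq. intros z. apply NNPP. intros Nz.
    apply K, (Hc t z), Nz. }
  destruct (ae_or_not HU (fun t => ap h t ∈ ap f t)) as [Hf|Hf]; [dfn| |].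
  - destruct (pred_ae_normalize h f Hf) as (h' & Hh' & E').
    assert (Hm : pi h' ∈ pi g) by (rewrite <- E; apply mem_pi; eauto).
    apply mem_pi in Hm. destruct Hm as (h2 & Hh2 & E2).
    assert (E3 := IH h' Hh' h2 E2).
    assert (K : mem_ae h g).
    { apply (mem_ae_congr h2 g h g).
      - exact (eq_ae_trans _ _ _ (eq_ae_sym _ _ E3) E').
      - apply eq_ae_refl.
      - apply Hh2. }
    destruct (ae_point HU _ (ae_and HU _ _ H (ae_and HU _ _ Hf K))) as (t & _ & ?). tauto.
  - assert (Hg : mem_ae h g) by (apply (ae_mono2 HU _ _ _ H Hf); intros t _ H1 H2; tauto).
    destruct (pred_ae_normalize h g Hg) as (h' & Hh' & E').
    assert (Hm : pi h' ∈ pi f) by (rewrite E; apply mem_pi; eauto).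
    apply mem_pi in Hm. destruct Hm as (h2 & Hh2 & E2).
    assert (E3 := IH h2 Hh2 h' (eq_sym E2)).
    assert (K : mem_ae h f).
    { apply (mem_ae_congr h2 f h f).
      - exact (eq_ae_trans _ _ _ E3 E').
      - apply eq_ae_refl.
      - apply Hh2. }
    destruct (ae_point HU _ (ae_and HU _ _ Hf K)) as (t & _ & ?). tauto.
Qed.

Lemma pi_eq (f g : V) : pi f = pi g <-> eq_ae f g.
Proof. split; [apply eq_ae_of_pi_eq|apply pi_eq_of_eq_ae]. Qed.

Lemma pi_mem (f g : V) : pi f ∈ pi g <-> mem_ae f g.
Proof.
  split.
  - intros H. apply mem_pi in H. destruct H as (h & [_ Hh] & E). apply pi_eq in E.
    exact (mem_ae_congr h g f g (eq_ae_sym _ _ E) (eq_ae_refl g) Hh).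
  - intros H. destruct (pred_ae_normalize f g H) as (h & Hh & E).
    apply mem_pi. exists h. split; [exact Hh|]. apply pi_eq. now apply eq_ae_sym.
Qed.

(** * Łoś's theorem and elementarity *)

Definition ult (y : V) : Prop := exists f, y = pi f.

Lemma ult_pi (f : V) : ult (pi f).
Proof. now exists f. Qed.

Lemma ult_transitive (x y : V) : ult x -> y ∈ x -> ult y.
Proof. intros [f ->] H. apply mem_pi in H. destruct H as (g & _ & ->). apply ult_pi. Qed.

Definition point (f : V) : substruct V ult := exist ult (pi f) (ult_pi f).

Lemma point_surj (x : substruct V ult) : exists f, x = point f.
Proof.
  destruct x as [y Hy]. assert (K := Hy). destruct K as [f ->]. exists f. unfold point.
  f_equal. apply proof_irrelevance.
Qed.

Lemma point_eq (f g : V) : point f = point g <-> eq_ae f g.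
Proof.
  rewrite <- pi_eq. split.
  - intros E. exact (f_equal (@proj1_sig V ult) E).
  - intros E. unfold point. generalize (ult_pi f) (ult_pi g). rewrite E. intros.
    f_equal. apply proof_irrelevance.
Qed.

Lemma Los_theorem (X : Set) (phi : set_formula X) : forall e : X -> V,
  holds (substruct V ult) phi (fun x => point (e x)) <->
  ae U (fun t => holds V phi (fun x => ap (e x) t)).
Proof.
  induction phi as [X i j|X i j|X i c|X|X p IHp q IHq|X p IHp]; intros e.
  - apply pi_mem.
  - apply point_eq.
  - destruct c.
  - split; [intros []|]. intros H. now destruct (ae_point HU _ H) as (t & _ & []).
  - assert (D : def1 (fun t => holds V p (fun x => ap (e x) t))).
    { intros Y t Ht. apply (def_holds Y X p (fun i x e' => ap (e x) (t i e'))).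
      intros x. repeat dfn_step. }
    change ((holds (substruct V ult) p (fun x => point (e x)) ->
             holds (substruct V ult) q (fun x => point (e x))) <->
      ae U (fun t => holds V p (fun x => ap (e x) t) -> holds V q (fun x => ap (e x) t))).
    rewrite IHp, IHq. split.
    + intros H. destruct (ae_or_not HU _ D) as [K|K].
      * apply (ae_mono HU _ _ (H K)). tauto.
      * apply (ae_mono HU _ _ K). tauto.
    + intros H K. apply (ae_mono2 HU _ _ _ H K). tauto.
  - assert (Hs : forall (M : estruct) (g : V -> M) f,
      (fun o => g (scons f e o)) = scons (g f) (fun x => g (e x))).
    { intros M g f. apply functional_extensionality. now intros [x|]. }
    change ((forall x, holds (substruct V ult) p (scons x (fun x => point (e x)))) <->
      ae U (fun t => forall x, holds V p (scons x (fun x => ap (e x) t)))).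
    split.
    + intros H.
      (* Choose a counterexample at each t that has one. The instance of H at the resulting function
         then excludes counterexamples almost everywhere. *)
      set (R := fun t x => ~ holds V p (scons x (fun i => ap (e i) t))).
      assert (DR : def2 R).
      { intros Y t s Ht Hs'. apply (def_not frm).
        apply (def_holds Y _ p
          (fun i o e' => match o with Some x => ap (e x) (t i e') | None => s i e' end)).
        intros [x|]; [repeat dfn_step|exact Hs']. }
      destruct (class_choice R DR) as (s & Hsd & Hc).
      assert (K := H (point (lam k s))). rewrite <- Hs in K.
      apply (IHp (scons (lam k s) e)) in K.
      apply (ae_mono HU _ _ K). intros t Ht Kt x. apply NNPP. intros Nx.
      assert (Rt := Hc t x Nx). unfold R in Rt. apply Rt.
      rewrite (Hs V (fun f => ap f t)), ap_lam in Kt by assumption. exact Kt.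
    + intros H x. destruct (point_surj x) as [f ->]. rewrite <- Hs.
      apply (IHp (scons f e)). apply (ae_mono HU _ _ H). intros t _ Kt.
      rewrite (Hs V (fun f => ap f t)). apply Kt.
Qed.

Lemma Los_pure (X : Set) (P : forall M : estruct, (X -> M) -> Prop) (e : X -> V) :
  definable pure P ->
  P (substruct V ult) (fun x => point (e x)) <-> ae U (fun t => P V (fun x => ap (e x) t)).
Proof.
  intros [phi H]. rewrite <- (H (substruct V ult) (fun x => point (e x))).
  replace (fun t => P V (fun x => ap (e x) t))
    with (fun t => holds V phi (fun x => ap (e x) t)); [exact (Los_theorem X phi e)|].
  apply functional_extensionality. intros t. apply propositional_extensionality.
  exact (H V (fun x => ap (e x) t)).
Qed.

Definition cst (a : V) : V := lam k (fun _ => a).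
Lemma ap_cst (a t : V) : t ∈ k -> ap (cst a) t = a.
Proof. intros Ht. apply (ap_lam k (fun _ => a)); [dfn|exact Ht]. Qed.
Lemma fun1_cst : fun1 cst.
Proof. unfold cst. dfn. Qed.
#[local] Hint Resolve fun1_cst : dfn.

Lemma elementary (X : Set) (P : forall M : estruct, (X -> M) -> Prop) (e : X -> V) :
  definable pure P -> P (substruct V ult) (fun x => point (cst (e x))) <-> P V e.
Proof.
  intros HP. rewrite (Los_pure X P (fun x => cst (e x)) HP).
  assert (E : forall t, t ∈ k -> (fun x => ap (cst (e x)) t) = e).
  { intros t Ht. apply functional_extensionality. intros x. now apply ap_cst. }
  split.
  - intros H. destruct (ae_point HU _ H) as (t & Ht & Pt). now rewrite (E t Ht) in Pt.
  - intros H. apply (ae_everywhere HU). intros t Ht. now rewrite (E t Ht).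
Qed.

Lemma elementary_sentence (P : estruct -> Prop) :
  @definable pure Empty_set (fun M _ => P M) -> P V -> P (substruct V ult).
Proof.
  intros HP H.
  exact (proj2 (elementary Empty_set (fun M _ => P M) (fun x => match x with end) HP) H).
Qed.

Lemma env_surj (X : Type) (e : X -> substruct V ult) : exists f, e = fun x => point (f x).
Proof.
  exists (fun x => proj1_sig (constructive_indefinite_description _ (point_surj (e x)))).
  apply functional_extensionality. intros x.
  now destruct constructive_indefinite_description.
Qed.

(** Since X may be infinite, parameters cannot always be quantified away in a sentence; Łoś's
    theorem is applied at arbitrary representatives instead. *)
Lemma ult_everywhere (X : Set) (P : forall M : estruct, (X -> M) -> Prop) :
  definable pure P -> (forall e, P V e) -> forall e, P (substruct V ult) e.
Proof.
  intros HP H e. destruct (env_surj X e) as [f ->].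
  apply (Los_pure X P f HP), (ae_everywhere HU). auto.
Qed.

Lemma zfc_ult : ZFC (substruct V ult).
Proof.
  destruct zfc_V. split;
    try (apply elementary_sentence; [solve [purify]|assumption]).
  - intros X phi e a.
    apply (ult_everywhere _ _ (pure_separation X phi)) with
      (e := fun o => match o with Some i => e i | None => a end).
    intros e'. apply separation_V.
  - intros X phi e a.
    apply (ult_everywhere _ _ (pure_replacement X phi)) with
      (e := fun o => match o with Some i => e i | None => a end).
    intros e'. apply replacement_V.
Qed.

(** * The elementary embedding *)

Definition j (a : V) : V := pi (cst a).
Lemma fun1_j : fun1 j.
Proof. unfold j. dfn. Qed.
#[local] Hint Resolve fun1_j : dfn.

Lemma j_mem (a b : V) : a ∈ b -> j a ∈ j b.
Proof.
  intros H. apply pi_mem, (ae_everywhere HU). intros t Ht. now rewrite !ap_cst.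
Qed.

(** Elementarity makes j(a) an ordinal in the sense of the ultrapower; as that is transitive, the
    members tested are the same in V. *)
Lemma ordinal_j (a : V) : ordinal a -> ordinal (j a).
Proof.
  intros Ha.
  assert (D : @definable pure unit (fun M e => ordinal (e tt))) by purify.
  destruct (proj2 (elementary unit (fun M e => ordinal (e tt)) (fun _ => a) D) Ha) as [T L].
  assert (K : forall x, x ∈ j a -> ult x).
  { intros x. apply ult_transitive, ult_pi. }
  split.
  - intros y Hy z Hz.
    exact (T (exist _ y (K y Hy)) Hy (exist _ z (ult_transitive y z (K y Hy) Hz)) Hz).
  - intros x y Hx Hy.
    destruct (L (exist _ x (K x Hx)) (exist _ y (K y Hy)) Hx Hy) as [H|[H|H]].
    + now left.
    + right. left. exact (f_equal (@proj1_sig V ult) H).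
    + now right; right.
Qed.

Lemma ult_ordinal (a : V) : ordinal a -> ult a.
Proof.
  intros Ha.
  (* For a minimal m with j(m) ∈ m, applying j gives j(j(m)) ∈ j(m), so j(m) would be a
     counterexample below m. *)
  assert (N : ~ j a ∈ a).
  { intros H.
    destruct (mem_minimal (fun a => j a ∈ a)) as (m & Hm & K); [dfn|eauto|].
    exact (K (j m) Hm (j_mem _ _ Hm)). }
  destruct (ordinal_compare a (j a) Ha (ordinal_j a Ha)) as [H|[->|H]].
  - exact (ult_transitive (j a) a (ult_pi _) H).
  - apply ult_pi.
  - contradiction.
Qed.

Lemma inner_model_ult : inner_model V ult.
Proof.
  split.
  - apply class_of_def1. unfold ult. dfn.
  - exact ult_transitive.
  - exact ult_ordinal.
  - exact zfc_ult.
Qed.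

(** A member of j(a) is represented by a function with values in a almost everywhere. As a is small,
    the function is almost everywhere a constant b, and it represents j(b) = b by induction. *)
Lemma j_fixed (a : V) : a ∈ stage k -> j a = a.
Proof.
  revert a. apply (mem_induction (fun a => a ∈ stage k -> j a = a)); [dfn|].
  intros a IH Ha. assert (Ha' := Ha). apply mem_stage in Ha'. destruct Ha' as (c & Hc & Hac).
  assert (Hin : forall b, b ∈ a -> b ∈ stage k).
  { intros b Hb. apply (stage_mono c k); [exact (proj1 (proj1 HU) c Hc)|now apply Hac]. }
  apply ext_eq. intros z. split.
  - intros Hz. unfold j in Hz. apply mem_pi in Hz. destruct Hz as (g & [_ Hg] & ->).
    destruct (small_subset HU (stage c) a (small_stage HU c Hc) Hac g) as (b & Hb & E).
    + apply (ae_mono HU _ _ Hg). intros t Ht. now rewrite ap_cst.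
    + replace (pi g) with b; [exact Hb|].
      rewrite <- (IH b Hb (Hin b Hb)) at 1. apply pi_eq.
      apply (ae_mono HU _ _ E). intros t Ht Et. now rewrite ap_cst.
  - intros Hz. rewrite <- (IH z Hz (Hin z Hz)). now apply j_mem.
Qed.

(** Under the assumption W = V this turns j into an elementary embedding of V into itself. *)
Lemma holds_total (W : V -> Prop) : (forall x, W x) ->
  forall (X : Set) (phi : set_formula X) (e : X -> substruct V W),
  holds (substruct V W) phi e <-> holds V phi (fun x => proj1_sig (e x)).
Proof.
  intros HW X phi.
  induction phi as [X x y|X x y|X x c|X|X p IHp q IHq|X p IHp]; intros e; unfold holds; simpl.
  - reflexivity.
  - split; [now intros ->|]. destruct (e x), (e y). simpl. intros ->.
    f_equal. apply proof_irrelevance.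
  - destruct c.
  - reflexivity.
  - unfold holds in *. now rewrite IHp, IHq.
  - assert (Hs : forall x, (fun o => proj1_sig (scons x e o))
                           = scons (proj1_sig x) (fun i => proj1_sig (e i))).
    { intros x. apply functional_extensionality. now intros [i|]. }
    split; intros H x.
    + specialize (H (exist W x (HW x))). apply IHp in H. now rewrite Hs in H.
    + apply IHp. rewrite Hs. apply H.
Qed.

Lemma proper_ult : proper V ult.
Proof.
  apply NNPP. intros N.
  assert (Hall : forall x, ult x) by (intros x; apply NNPP; intros Nx; apply N; now exists x).
  assert (Hj : measure (j k) (j U)).
  { destruct pure_measure as [phi Hphi].
    assert (K := proj2 (Hphi V (fun b : bool => if b then k else U)) HU).
    assert (D : @definable pure bool (fun M e => holds M phi e)) by (exists phi; reflexivity).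
    apply (proj2 (elementary bool (fun M e => holds M phi e) (fun b => if b then k else U) D)) in K.
    apply (holds_total ult Hall) in K. exact (proj1 (Hphi V _) K). }
  (* The identity represents an ordinal below j(k) that is no value of j, because it is almost
     nowhere equal to a given constant. Ordinals below k are fixed by j, so all of them lie below d.
     Thus k ⊆ d ∈ j(k). *)
  set (d := pi (lam k (fun t => t))).
  assert (Hid : forall t, t ∈ k -> ap (lam k (fun t => t)) t = t).
  { intros t Ht. apply (ap_lam k (fun t => t)); [dfn|exact Ht]. }
  assert (Hfix : forall a, a ∈ k -> j a = a).
  { intros a Ha. apply j_fixed, subset_stage, Ha. }
  assert (Hd : d ∈ j k).
  { apply pi_mem, (ae_everywhere HU). intros t Ht. now rewrite Hid, ap_cst. }
  assert (Hne : forall a, j a <> d).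
  { intros a E. apply pi_eq in E.
    destruct (ae_point HU _ (ae_and HU _ _ E (ae_neq HU a))) as (t & Ht & H1 & H2).
    rewrite Hid, ap_cst in H1 by exact Ht. congruence. }
  assert (Hkd : subset k d).
  { intros a Ha.
    assert (Haj : a ∈ j k) by (rewrite <- (Hfix a Ha); now apply j_mem).
    destruct (proj2 (proj1 Hj) a d Haj Hd) as [H|[->|H]]; [exact H| |].
    - destruct (Hne d). now apply Hfix.
    - destruct (Hne d). apply Hfix. exact (proj1 (proj1 HU) a Ha d H). }
  (* A representative of a member of j(k) has values in k almost everywhere, so its graph can be cut
     down to a subset of k × k. The map s is injective because [pi] recovers c from [s c]. *)
  destruct (class_choice (fun c g => g ∈ pow (prod k k) /\ c = pi g)) as (s & Hs & Hc); [dfn|].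
  assert (Hrep : forall c, c ∈ j k -> s c ∈ pow (prod k k) /\ c = pi (s c)).
  { intros c Hcj. apply mem_pi in Hcj. destruct Hcj as (g & [_ Hg] & E).
    destruct (is_set_sep (prod k k) (fun p => exists x, p = pr x (ap g x))) as [h Hh]; [dfn|].
    apply (Hc c h). split.
    - apply mem_pow. intros p Hp. now apply Hh in Hp.
    - rewrite E. apply pi_eq. apply (ae_mono HU _ _ Hg). intros t Ht Hgt.
      rewrite ap_cst in Hgt by exact Ht. symmetry. apply ap_eq.
      + apply Hh. split; [apply mem_prod; eauto|eauto].
      + intros y Hy. apply Hh in Hy. destruct Hy as [_ (x & Exy)].
        apply pr_inj in Exy. now destruct Exy as [<- ->]. }
  apply (no_injection_pow_prod Hj d k s Hd Hkd Hs).
  - intros c Hcj. now apply Hrep.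
  - intros a b Ha Hb E. rewrite (proj2 (Hrep a Ha)), (proj2 (Hrep b Hb)). now rewrite E.
Qed.

Lemma reflection_ult (X : Set) (phi : set_formula X) (e : X -> V) :
  (forall x, e x ∈ stage k) -> holds V phi e ->
  exists He : forall x, ult (e x),
    holds (substruct V ult) phi (fun x => exist _ (e x) (He x)).
Proof.
  intros Hst H.
  assert (He : forall x, ult (e x)).
  { intros x. rewrite <- (j_fixed (e x) (Hst x)). apply ult_pi. }
  exists He.
  assert (D : @definable pure X (fun M e => holds M phi e)) by (exists phi; reflexivity).
  apply (elementary X (fun M e => holds M phi e) e D) in H.
  replace (fun x => exist _ (e x) (He x)) with (fun x => point (cst (e x))); [exact H|].
  apply functional_extensionality. intros x. unfold point. generalize (ult_pi (cst (e x))).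
  change (pi (cst (e x))) with (j (e x)). rewrite (j_fixed (e x) (Hst x)).
  intros p. f_equal. apply proof_irrelevance.
Qed.
End Ultrapower.

(** One W, depending only on the measure, serves all formulas. Arbitrary X covers sentences and
    formulas with a parameter alike. *)
Lemma measurable_reflection (k : V) : measurable k -> exists W : V -> Prop,
  inner_model V W /\ proper V W /\
  forall (X : Set) (phi : set_formula X) (e : X -> V),
    (forall x, e x ∈ stage k) -> holds V phi e ->
    exists He : forall x, W (e x), holds (substruct V W) phi (fun x => exist _ (e x) (He x)).
Proof.
  intros [[[Ok _] (w & [[Ow [Hne Hlim]] _] & Hw)] (U & Huf & Hnp & Hco)].
  assert (HU : measure k U) by (repeat split; assumption || apply Ok || apply Huf).
  (* A limit ordinal offers some m with n ∈ m ∈ w, and the successor of n is m or belongs to m. *)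
  assert (Hsucc : forall n, n ∈ w -> succ n ∈ w).
  { intros n Hn. destruct (Hlim n Hn) as (m & Hm & Hnm).
    destruct (ordinal_subset (succ n) m) as [->|H]; try assumption.
    - apply ordinal_succ. exact (ordinal_mem w n Ow Hn).
    - exact (ordinal_mem w m Ow Hm).
    - intros z Hz. apply mem_succ in Hz. destruct Hz as [Hz| ->]; [|exact Hnm].
      exact (proj1 (ordinal_mem w m Ow Hm) n Hnm z Hz).
    - exact (proj1 Ow m Hm _ H). }
  exists (ult k U HU w Hw Hne Hsucc). split; [apply inner_model_ult|].
  split; [apply proper_ult|]. apply reflection_ult.
Qed.

(** * The cumulative hierarchy and the location of measurable cardinals *)

Lemma is_V_stage (a v : V) : ordinal a -> is_V a v -> v = stage a.
Proof.
  intros Oa (f & s & Hs & [_ Hf] & Hrec & Hav).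
  assert (K : forall b, b ∈ s -> forall y, app f b y -> y = stage b).
  { apply (mem_induction (fun b => b ∈ s -> forall y, app f b y -> y = stage b)).
    - intros X t Ht. repeat dfn_step. unfold app, is_pair. repeat dfn_step.
    - intros b IH Hb y Hy. apply ext_eq. intros x.
      assert (Hcs : forall c, c ∈ b -> c ∈ s).
      { intros c Hc. apply Hs. left. apply Hs in Hb. destruct Hb as [Hb| ->]; [|exact Hc].
        exact (proj1 Oa b Hb c Hc). }
      rewrite (Hrec b y Hy x), mem_stage. split.
      + intros (c & z & Hc & Hz & Hx). exists c. split; [exact Hc|].
        now rewrite <- (IH c Hc (Hcs c Hc) z Hz).
      + intros (c & Hc & Hx). destruct (Hf c (Hcs c Hc)) as (z & Hz & _).
        exists c, z. split; [exact Hc|]. split; [exact Hz|].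
        now rewrite (IH c Hc (Hcs c Hc) z Hz). }
  apply K; [|exact Hav]. apply Hs. now right.
Qed.

Lemma stage_is_V (a : V) : ordinal a -> is_V a (stage a).
Proof.
  intros Oa. exists (lam (succ a) stage), (succ a).
  assert (Happ : forall x y, app (lam (succ a) stage) x y <-> x ∈ succ a /\ y = stage x).
  { intros x y. rewrite app_pr. apply pr_mem_lam, fun1_stage. }
  split; [intros z; apply mem_succ|]. split; [split|split].
  - intros p Hp. apply mem_lam in Hp; [|apply fun1_stage]. destruct Hp as (x & Hx & ->).
    exists x, (stage x). split; [exact Hx|now apply is_pair_pr].
  - intros x Hx. exists (stage x). split; [now apply Happ|].
    intros y Hy. now apply Happ in Hy.
  - intros b y Hb x. apply Happ in Hb. destruct Hb as [Hb ->]. rewrite mem_stage. split.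
    + intros (c & Hc & Hx). exists c, (stage c). split; [exact Hc|]. split; [|exact Hx].
      apply Happ. split; [|reflexivity]. exact (proj1 (ordinal_succ a Oa) b Hb c Hc).
    + intros (c & z & Hc & Hz & Hx). apply Happ in Hz. destruct Hz as [_ ->]. eauto.
  - apply Happ. rewrite mem_succ. tauto.
Qed.

Lemma in_V_stage (k a : V) : ordinal k -> (in_V k a <-> a ∈ stage k).
Proof.
  intros Ok. split.
  - intros (v & Hv & Ha). now rewrite <- (is_V_stage k v Ok Hv).
  - intros Ha. exists (stage k). split; [now apply stage_is_V|exact Ha].
Qed.

Lemma def1_measurable : def1 measurable.
Proof.
  intros X t Ht.
  unfold measurable, uncountable_cardinal, cardinal, is_omega, limit_ordinal, principal, complete,
    card_lt, equipotent, bijection, function_on, app, is_pair, unique.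
  repeat dfn_step.
  apply def_ext with (2 := fun i e => ultrafilter_on_iff V (e None) (t i (fun x => e (Some x)))).
  repeat dfn_step.
Qed.

Lemma reflection_below (k : V) :
  measurable k -> reflection_with_parameters_in V (fun a => in_V k a).
Proof.
  intros Hk phi a Ha Hphi.
  apply in_V_stage in Ha; [|apply Hk].
  destruct (measurable_reflection k Hk) as (W & HW & HpW & Hrefl).
  exists W. split; [exact HW|]. split; [exact HpW|].
  destruct (Hrefl unit phi (fun _ => a)) as [He H]; [auto|exact Hphi|].
  exists (He tt). unfold true_of.
  replace (fun _ : unit => exist W a (He tt)) with (fun x => exist W a (He x)); [exact H|].
  apply functional_extensionality. now intros [].
Qed.

(** If a lies in V_b but in no V_k with k measurable, all measurable cardinals are at most b and
    hence form a set. *)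
Lemma measurable_above (a : V) :
  proper_class_of_measurables V -> exists k, measurable k /\ in_V k a.
Proof.
  intros Hpc. apply NNPP. intros N. apply Hpc.
  destruct (in_stage a) as (b & Ob & Hb).
  assert (D := def1_measurable).
  apply (is_set_sub (fun k => k ∈ succ b)); [apply is_set_mem|exact D|].
  intros k Hk. apply mem_succ.
  assert (Ok : ordinal k) by apply Hk.
  destruct (ordinal_compare k b Ok Ob) as [H|[H|H]]; auto.
  destruct N. exists k. split; [exact Hk|]. apply in_V_stage; [exact Ok|].
  apply (stage_mono b); [exact (proj1 Ok b H)|exact Hb].
Qed.

End UniverseOfSets.

Theorem theorem3p1 (V : class_struct) (hV : GBC V) :
  ((exists k : V, measurable k) -> lightface_reflection V) /\
  (forall k : V, measurable k ->
     reflection_with_parameters_in V (fun a : V => in_V k a)) /\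
  (proper_class_of_measurables V -> full_reflection V).
Proof.
  split; [|split].
  - intros [k Hk] phi Hphi.
    destruct (measurable_reflection V hV k Hk) as (W & HW & HpW & Hrefl).
    exists W. split; [exact HW|]. split; [exact HpW|].
    set (e := fun i : Empty_set => match i return V with end).
    destruct (Hrefl Empty_set phi e) as [He H]; [intros []|exact Hphi|].
    unfold true_in.
    replace (fun i : Empty_set => match i return substruct V W with end)
      with (fun x => exist W (e x) (He x) : substruct V W); [exact H|].
    apply functional_extensionality. intros [].
  - exact (reflection_below V hV).
  - intros Hpc phi a _ Hphi.
    destruct (measurable_above V hV a Hpc) as (k & Hk & Ha).
    exact (reflection_below V hV k Hk phi a Ha Hphi).
Qed.
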